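(* Let $d\geqslant2$ and let $\alpha$ be a mixing Noetherian entropy rank one $\mathbb{Z}^d$-action by continuous automorphisms of a compact metrizable abelian zero-dimensional group $X$, with dual $R_d$-module $M$. Then for every $\varepsilon>0$, the set $\{\mathsf{F}_\alpha(\Lambda):\Lambda\in\mathcal{L}_d(\mathbb{P}(\alpha),\varepsilon)\}$ is finite.
   Context: $R_d=\mathbb{Z}[u_1^{\pm1},\dots,u_d^{\pm1}]$; $M=\widehat{X}$ is an $R_d$-module with $u^{\mathbf{n}}$ acting as the dual of $\alpha^{\mathbf{n}}$; Noetherian means $M$ is a Noetherian $R_d$-module; entropy rank one means each $\alpha^{\mathbf{n}}$ has finite topological entropy; mixing is with respect to Haar measure. $\mathcal{L}_d$ is the set of finite-index subgroups of $\mathbb{Z}^d$, $[\Lambda]=|\mathbb{Z}^d/\Lambda|$, $\mathsf{F}_\alpha(\Lambda)$ the number of points fixed by all $\alpha^{\mathbf{n}}$, $\mathbf{n}\in\Lambda$. $\mathbb{P}$ is the set of rational primes, $\mathbb{P}(\alpha)=\{p\in\mathbb{P}: p\in\mathfrak{p}\text{ for some associated prime }\mathfrak{p}\in\operatorname{Ass}(M)\}$. For primes $p\neq q$, $m_p(q)$ is the multiplicative order of $p$ modulo $q$. For a finite set $P\subset\mathbb{P}$ and $\varepsilon>0$, $\mathcal{L}_d(P,\varepsilon)=\{\Lambda\in\mathcal{L}_d: [\Lambda]\in\mathbb{P}\setminus P \text{ and } m_p([\Lambda])>[\Lambda]^{\frac1d+\varepsilon}\text{ for all }p\in P\}$. 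*)

(* Defs.v *)
From HB Require Import structures.
From mathcomp Require Import all_boot all_order all_algebra.
From mathcomp Require Import all_classical all_reals all_analysis.
Set Implicit Arguments. Unset Strict Implicit. Unset Printing Implicit Defensive.
Import Order.TTheory GRing.Theory Num.Theory.
Import numFieldNormedType.Exports.
Local Open Scope classical_set_scope.
Local Open Scope ring_scope.

Definition is_action (d : nat) (X : topologicalZmodType)
  (alpha : 'rV[int]_d -> X -> X) : Prop :=
  [/\ (forall x, alpha 0 x = x),
      (forall m n x, alpha (m + n) x = alpha m (alpha n x)),
      (forall n x y, alpha n (x + y) = alpha n x + alpha n y) &
      (forall n, continuous (alpha n))].

Definition metrizable (R : realType) (T : topologicalType) : Prop :=
  exists dist : T -> T -> R,
    [/\ (forall x y, 0 <= dist x y),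
        (forall x y, dist x y = 0 <-> x = y),
        (forall x y, dist x y = dist y x),
        (forall x y z, dist x z <= dist x y + dist y z) &
        (forall A : set T, open A <->
           (forall x, A x -> exists2 r : R, 0 < r & [set y | dist x y < r] `<=` A))].

(* A character chi : X -> T = R/Z is represented by a real function c with
   chi(x) = c(x) mod 1. *)
Definition intval (R : realType) (r : R) : Prop := exists z : int, r = z%:~R.

Definition is_char (R : realType) (X : topologicalZmodType) (c : X -> R) : Prop :=
  (forall x y, intval (c (x + y) - c x - c y)) /\
  continuous (fun x => cos (2 * pi * c x)) /\
  continuous (fun x => sin (2 * pi * c x)).

Definition zero_char (R : realType) (X : Type) (c : X -> R) : Prop :=
  forall x, intval (c x).

(* Elements of R_d = Z[u_1^{+-1},...,u_d^{+-1}] as finite lists of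
   (coefficient, exponent) pairs: sum of a * u^n. *)
Definition laurent (d : nat) := seq (int * 'rV[int]_d).

Definition lmul (d : nat) (f g : laurent d) : laurent d :=
  [seq (a.1 * b.1, a.2 + b.2) | a <- f, b <- g].

(* module action: u^n acts as the dual of alpha^n, (u^n . chi)(x) = chi(alpha^n x) *)
Definition act (R : realType) (d : nat) (X : Type) (alpha : 'rV[int]_d -> X -> X)
  (f : laurent d) (c : X -> R) : X -> R :=
  fun x => \sum_(t <- f) (t.1)%:~R * c (alpha t.2 x).

Definition submodule (R : realType) (d : nat) (X : topologicalZmodType)
  (alpha : 'rV[int]_d -> X -> X) (N : set (X -> R)) : Prop :=
  [/\ N `<=` @is_char R X,
      N (fun _ => 0),
      (forall c c', N c -> N c' -> N (fun x => c x + c' x)),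
      (forall f c, N c -> N (act alpha f c)) &
      (forall c c', N c -> is_char c' -> zero_char (fun x => c' x - c x) -> N c')].

Definition noetherian (R : realType) (d : nat) (X : topologicalZmodType)
  (alpha : 'rV[int]_d -> X -> X) : Prop :=
  forall N : nat -> set (X -> R),
    (forall k, submodule alpha (N k)) -> (forall k, N k `<=` N k.+1) ->
    exists K, forall k, (K <= k)%N -> N k = N K.

(* p in P(alpha): p lies in some associated prime ann(chi) of M *)
Definition in_Palpha (R : realType) (d : nat) (X : topologicalZmodType)
  (alpha : 'rV[int]_d -> X -> X) (p : nat) : Prop :=
  prime p /\
  exists c : X -> R,
    [/\ is_char c, ~ zero_char c,
        (forall f g : laurent d, zero_char (act alpha (lmul f g) c) ->
            zero_char (act alpha f c) \/ zero_char (act alpha g c)) &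
        zero_char (act alpha [:: (p%:Z, 0)] c)].

(* The join U v T^{-1}U v ... v T^{-(n-1)}U (U a finite open cover given as a
   seq) can be covered by at most k of its members. *)
Definition join_cover_le (X : Type) (T : X -> X) (U : seq (set X)) (n k : nat) : Prop :=
  exists s : seq (seq nat),
    [/\ (size s <= k)%N,
        (forall w, w \in s -> size w = n) &
        (forall x, exists2 w, w \in s &
            forall i, (i < n)%N -> nth set0 U (nth 0%N w i) (iter i T x))].

Definition open_cover (X : topologicalType) (U : seq (set X)) : Prop :=
  (forall i, (i < size U)%N -> open (nth set0 U i)) /\
  (forall x, exists2 i, (i < size U)%N & nth set0 U i x).

(* h_top(T) < oo : sup over finite open covers U of
   lim (1/n) log N(U v ... v T^{-(n-1)}U) is finite *)
Definition finite_entropy (R : realType) (X : topologicalType) (T : X -> X) : Prop :=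
  exists C : R, forall U, open_cover U ->
    \forall n \near \oo, exists2 k : nat, ln (k%:R : R) <= C * n%:R &
                                          join_cover_le T U n k.

Definition entropy_rank_one (R : realType) (d : nat) (X : topologicalType)
  (alpha : 'rV[int]_d -> X -> X) : Prop :=
  forall n, @finite_entropy R X (alpha n).

Definition borel (X : topologicalType) : set (set X) := <<s open >>.

Definition haar (R : realType) (X : topologicalZmodType) (mu : set X -> R) : Prop :=
  [/\ (forall A, borel A -> 0 <= mu A),
      mu setT = 1,
      (forall F : nat -> set X, (forall k, borel (F k)) ->
         trivIset setT F ->
         (fun n => \sum_(k < n) mu (F k)) @ \oo --> mu (\bigcup_k F k)) &
      (forall x A, borel A -> mu ((fun y => x + y) @` A) = mu A)].

Definition mixing (R : realType) (d : nat) (X : topologicalZmodType)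
  (alpha : 'rV[int]_d -> X -> X) : Prop :=
  forall mu : set X -> R, haar mu ->
  forall A B : set X, borel A -> borel B ->
  forall eta : R, 0 < eta -> exists K : nat, forall n : 'rV[int]_d,
    (exists i : 'I_d, (K < `|n ord0 i|)%N) ->
    `| mu (A `&` alpha n @^-1` B) - mu A * mu B | < eta.

Definition subgroupZd (d : nat) (L : set 'rV[int]_d) : Prop :=
  L 0 /\ forall m n, L m -> L n -> L (m - n).

Definition index_is (d : nat) (L : set 'rV[int]_d) (k : nat) : Prop :=
  exists s : seq 'rV[int]_d,
    [/\ size s = k,
        (forall v, exists2 i, (i < k)%N & L (v - nth 0 s i)) &
        (forall i j, (i < k)%N -> (j < k)%N -> L (nth 0 s i - nth 0 s j) -> i = j)].

Definition mult_order (p q k : nat) : Prop :=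
  [/\ (0 < k)%N, p ^ k = 1 %[mod q] &
      forall j, (0 < j)%N -> (j < k)%N -> p ^ j <> 1 %[mod q]].

Definition in_Ld (R : realType) (d : nat) (X : topologicalZmodType)
  (alpha : 'rV[int]_d -> X -> X) (eps : R) (L : set 'rV[int]_d) : Prop :=
  subgroupZd L /\
  exists q : nat,
    [/\ index_is L q, prime q, ~ @in_Palpha R d X alpha q &
        forall p, @in_Palpha R d X alpha p -> forall m, mult_order p q m ->
          (q%:R : R) `^ ((d%:R)^-1 + eps) < m%:R].

Definition Fix (d : nat) (X : Type) (alpha : 'rV[int]_d -> X -> X)
  (L : set 'rV[int]_d) : set X :=
  [set x | forall n, L n -> alpha n x = x].

(* Main.v *)
(* Everything is proved on [X] itself, open subgroups playing the role of finite subgroups of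
   the dual module [M].  Let [L] have prime index [q], with [Fix L] finite, and suppose some
   point of [Fix L] is moved by the action.

   Lower bound: [Z^d / L] has order [q] and acts on [Fix L]; for some prime [p] the subgroup
   [V] of [p]-torsion elements of norm zero is nontrivial, and the action on [V] has no nonzero
   fixed point, so [|V| = p^a = 1 mod q].  Hence [m_p(q) <= a], and [p] lies in [P(alpha)].

   Upper bound: by pigeonhole [L] contains [n <> 0] with [|n| <= q^(1/d)], and [V] is fixed by
   [alpha n].  By mixing [alpha n - 1] is onto; adding preimages under its powers lifts [V^N] to
   points which a fixed open subgroup separates over a box of side [N |n|].  On the [p]-part of [X] finite
   entropy of [T = alpha e_1] gives, for every [i], a relation between [T] and [alpha e_i] with
   extreme coefficients nonzero mod [p]; such a coefficient divides some [T^a (T^b - 1)] mod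
   [p], hence is onto.  After division by its [N |n|]-th power the pattern over the box is
   determined by a [T]-orbit segment of length [O(N |n|)], and finite entropy of [T] yields
   [ln |V| <= C |n|].

   For large [q] the two bounds contradict [m_p(q) > q^(1/d + eps)], so [Fix L] is the group of
   points fixed by the whole action; small [q] leave finitely many [L].  Mixing is only assumed
   relative to a Haar measure, which therefore has to be constructed. *)
From mathcomp Require Import perm fingroup action pgroup cyclic sylow.
From mathcomp Require Import finmap.
Require Import Defs.
From HB Require Import structures.
From mathcomp Require Import all_boot all_order all_algebra.
From mathcomp Require Import all_classical all_reals all_analysis.
Import Order.TTheory GRing.Theory Num.Theory.
Import numFieldNormedType.Exports.
Local Open Scope classical_set_scope.
Local Open Scope ring_scope.
Set Implicit Arguments. Unset Strict Implicit. Unset Printing Implicit Defensive.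
From mathcomp Require Import ring lra zify.

(** * Open subgroups of a compact zero-dimensional group *)

(** The entropy estimate holds only beyond a threshold that depends on the open subgroup, and the
    subgroup separating the points of V depends on V, so applying it to V directly gives no uniform
    constant. With N copies of V, N beyond the threshold, box and orbit segment grow linearly in N
    and N cancels from both sides. For this the loss of window per unit step must be fixed before
    the open subgroup is chosen. Norm zero is what excludes fixed points: a fixed v of norm zero
    satisfies q v = 0 as well as p v = 0, and p differs from q because q is not in P(alpha). The
    constant C is found for each p separately; it becomes uniform because X has bounded exponent, so
    that only finitely many p carry torsion. The exponent 1/d is that of the short vector in L, and
    q^eps absorbs C. *)

Definition subgroup (V : zmodType) (A : set V) : Prop :=
  A 0 /\ forall x y, A x -> A y -> A (x - y).

Lemma subgroup0 (V : zmodType) (A : set V) : subgroup A -> A 0.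
Proof. by case. Qed.

Lemma subgroupB (V : zmodType) (A : set V) (x y : V) :
  subgroup A -> A x -> A y -> A (x - y).
Proof. by case=> _ h; exact: h. Qed.

Lemma subgroupN (V : zmodType) (A : set V) (x : V) :
  subgroup A -> A x -> A (- x).
Proof. by move=> gA Ax; rewrite -sub0r; apply: subgroupB => //; case: gA. Qed.

Lemma subgroupD (V : zmodType) (A : set V) (x y : V) :
  subgroup A -> A x -> A y -> A (x + y).
Proof.
by move=> gA Ax Ay; rewrite -(opprK y); apply: subgroupB => //; exact: subgroupN.
Qed.

Lemma subgroup_sum (V : zmodType) (A : set V) (I : Type) (r : seq I) (P : pred I)
    (F : I -> V) :
  subgroup A -> (forall i, P i -> A (F i)) -> A (\sum_(i <- r | P i) F i).
Proof.
move=> gA AF; elim/big_ind: _ => //; first exact: subgroup0.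
by move=> x y; exact: subgroupD.
Qed.

Lemma subgroupMn (V : zmodType) (A : set V) (x : V) (n : nat) :
  subgroup A -> A x -> A (x *+ n).
Proof.
move=> gA Ax; elim: n => [|n IH]; first by rewrite mulr0n; exact: subgroup0.
by rewrite mulrS; exact: subgroupD.
Qed.

Lemma subgroupMz (V : zmodType) (A : set V) (x : V) (n : int) :
  subgroup A -> A x -> A (x *~ n).
Proof.
move=> gA Ax; case: n => n; first exact: subgroupMn.
by rewrite NegzE mulrNz; apply: subgroupN => //; exact: subgroupMn.
Qed.

Lemma subgroupDl (V : zmodType) (A : set V) (x y : V) :
  subgroup A -> A x -> A (x + y) <-> A y.
Proof.
move=> gA Ax; split=> [Axy|Ay]; last exact: subgroupD.
by have := subgroupB gA Axy Ax; rewrite addrC addKr.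
Qed.

Lemma subgroup_sym (V : zmodType) (A : set V) (x y : V) :
  subgroup A -> A (x - y) -> A (y - x).
Proof. by move=> gA /(subgroupN gA); rewrite opprB. Qed.

Lemma subgroup_trans (V : zmodType) (A : set V) (x y z : V) :
  subgroup A -> A (x - y) -> A (y - z) -> A (x - z).
Proof.
by move=> gA h1 h2; have := subgroupD gA h1 h2; rewrite addrA subrK.
Qed.

Lemma coprime_torsion_eq0 (V : zmodType) (x : V) (p s : nat) : (0 < p)%N -> coprime p s ->
  x *+ p = 0 -> x *+ s = 0 -> x = 0.
Proof.
move=> p0 ps px sx; have [u v e _] := egcdnP s p0.
have := congr1 (fun k => x *+ k) e.
by rewrite /= mulrnDr (eqP ps) (mulnC u) (mulrnA x p) px mul0rn (mulnC v) (mulrnA x s) sx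
  mul0rn add0r mulr1n.
Qed.

Lemma decreasing_subset (T : Type) (U_ : nat -> set T) : (forall k, U_ k.+1 `<=` U_ k) ->
  forall i j, (i <= j)%N -> U_ j `<=` U_ i.
Proof.
move=> dU i; elim=> [|j IH]; first by rewrite leqn0 => /eqP ->.
by rewrite leq_eqVlt => /predU1P[->//|/IH h] z /dU /h.
Qed.

Definition opensub (X : topologicalZmodType) (U : set X) : Prop :=
  open U /\ subgroup U.

Section TopologicalGroup.
Variable X : topologicalZmodType.
Implicit Types (U O A : set X) (x y : X).

Lemma addl_continuous x : continuous (fun y : X => x + y).
Proof.
move=> y; apply: (@continuous_comp _ _ _ (fun y => (x, y)) (fun z : X * X => z.1 + z.2)).
  by apply: cvg_pair => /=; [exact: cvg_cst|exact: cvg_id].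
exact: add_continuous.
Qed.

Lemma open_translate x A : open A -> open [set y | A (x + y)].
Proof. by move=> oA; apply: (open_comp _ oA) => y _; exact: addl_continuous. Qed.

Lemma closed_translate x A : closed A -> closed [set y | A (x + y)].
Proof. by move=> oA; apply: (closed_comp _ oA) => y _; exact: addl_continuous. Qed.

Lemma nbhs0_translate x A : nbhs x A -> nbhs 0 [set y | A (x + y)].
Proof.
by move=> nA; have := @addl_continuous x 0; rewrite /continuous_at addr0; apply.
Qed.

Lemma subgroup_open A : subgroup A -> nbhs 0 A -> open A.
Proof.
move=> gA nA; rewrite openE => x Ax; rewrite /interior.
have : nbhs (- x + x) A by rewrite addNr.
move=> /(@addl_continuous (- x) x) /=; rewrite nbhs_simpl /=.
apply: filterS => y /= h.
by rewrite -(addrNK x y) addrC; apply: subgroupD => //; rewrite addrC.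
Qed.

Lemma opensub_nbhs U : opensub U -> nbhs 0 U.
Proof. by case=> oU [U0 _]; apply: open_nbhs_nbhs. Qed.

Lemma opensub_setT : opensub [set: X].
Proof. by split; [exact: openT|]. Qed.

Lemma opensubI U U' : opensub U -> opensub U' -> opensub (U `&` U').
Proof.
move=> [oU gU] [oU' gU']; split; first exact: openI.
split; first by split; exact: subgroup0.
by move=> x y [? ?] [? ?]; split; exact: subgroupB.
Qed.

Lemma opensub_bigI (n : nat) (F : nat -> set X) :
  (forall i, opensub (F i)) -> opensub [set x | forall i, (i < n)%N -> F i x].
Proof.
move=> oF; elim: n => [|n IH].
  by rewrite (_ : mkset _ = setT); [exact: opensub_setT|apply/seteqP; split].
rewrite (_ : mkset _ = [set x | forall i, (i < n)%N -> F i x] `&` F n).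
  exact: opensubI.
apply/seteqP; split=> [x h|x [h1 h2] i]; rewrite /=.
  by split=> [i /= lin|]; apply: h => //; exact: leqW.
by rewrite ltnS leq_eqVlt => /predU1P[->//|]; exact: h1.
Qed.

Lemma opensub_preim U (f : X -> X) : opensub U -> continuous f ->
  (forall x y, f (x + y) = f x + f y) -> opensub (f @^-1` U).
Proof.
move=> [oU gU] cf fD; split; first by apply: (open_comp _ oU) => x _; exact: cf.
have f0 : f 0 = 0 by apply: (addIr (f 0)); rewrite -fD !add0r.
have fN x : f (- x) = - f x by apply: (addrI (f x)); rewrite -fD !subrr.
split; rewrite /= ?f0; first exact: subgroup0.
by move=> x y h1 h2 /=; rewrite fD fN; exact: subgroupB.
Qed.

Lemma opensub_sumset U A : opensub U -> subgroup A ->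
  opensub [set x | exists2 a, A a & U (x - a)].
Proof.
move=> oU gA; have gU := oU.2.
have gS : subgroup [set x | exists2 a, A a & U (x - a)].
  split; first by exists 0; rewrite ?subr0; exact: subgroup0.
  move=> x y [a Aa Ua] [b Ab Ub]; exists (a - b); first exact: subgroupB.
  by rewrite opprD addrACA -opprD; exact: subgroupB.
split=> //; apply: subgroup_open => //.
apply: filterS (opensub_nbhs oU) => x Ux /=.
by exists 0; rewrite ?subr0 //; exact: subgroup0.
Qed.

Lemma opensub_coset_open U x : opensub U -> open [set y | U (y - x)].
Proof.
move=> [oU _]; rewrite (_ : mkset _ = [set y | U (- x + y)]); first exact: open_translate.
by apply/seteqP; split=> y /=; rewrite addrC.
Qed.

Lemma saturated_open U A : opensub U ->
  (forall x y, A x -> U (y - x) -> A y) -> open A.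
Proof.
move=> oU sat; rewrite openE => x Ax; rewrite /interior.
have : nbhs x [set y | U (y - x)].
  apply: open_nbhs_nbhs; split; first exact: opensub_coset_open.
  by rewrite /= subrr; exact: subgroup0 oU.2.
by apply: filterS => y; exact: sat.
Qed.

Lemma saturated_clopen U A : opensub U ->
  (forall x y, A x -> U (y - x) -> A y) -> clopen A.
Proof.
move=> oU sat; split; first exact: (saturated_open oU).
rewrite -openC; apply: (saturated_open oU) => x y nAx Uyx Ay; apply: nAx.
by apply: (sat _ _ Ay); exact: (subgroup_sym oU.2).
Qed.

Lemma opensub_clopen U : opensub U -> clopen U.
Proof.
move=> oU; apply: (saturated_clopen oU) => x y Ux h.
by rewrite -(subrK x y); exact: (subgroupD oU.2 h Ux).
Qed.

Hypothesis cX : compact [set: X].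

Lemma opensub_cosets U : opensub U ->
  exists l : seq X, forall x, exists2 i, (i < size l)%N & U (x - nth 0 l i).
Proof.
move=> oU.
have /compact_near_coveringP ncX := cX.
(* Near-covering compactness is applied along the filter of finite lists ordered by inclusion, so
   the list it yields is the finite subcover. *)
pose F := filter_from [set: seq X] (fun l => [set l' : seq X | {subset l <= l'}]).
have FF : Filter F.
  apply: filter_from_filter; first by exists [::].
  move=> l1 l2 _ _; exists (l1 ++ l2) => // l /= sl; split=> x xl /=;
    by apply: sl; rewrite mem_cat xl ?orbT.
have [|l _ hl] := ncX (seq X) F (fun l x => exists2 y, y \in l & U (x - y)) FF.
  move=> x _; exists ([set y | U (y - x)], [set l : seq X | x \in l]) => /=.
    split; last by exists [:: x] => // l /= sl; apply: sl; rewrite inE.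
    apply: open_nbhs_nbhs; split; first exact: opensub_coset_open.
    by rewrite /= subrr; exact: subgroup0 oU.2.
  by move=> [y l] /= [h1 h2]; exists x.
exists l => x; have [y yl Uxy] := hl l (fun _ => id) x Logic.I.
by exists (index y l); rewrite ?index_mem ?nth_index.
Qed.

Lemma opensub_label U : opensub U ->
  exists (k : nat) (lab : X -> 'I_k), forall x y, lab x = lab y <-> U (x - y).
Proof.
move=> oU; have [l hl] := opensub_cosets oU; have gU := oU.2.
(* The label is the first listed representative of the coset of [x]; taking the first makes it
   unique even if the list meets a coset twice. *)
have hlt x : (find (fun y => `[< U (x - y)%R >]) l < size l)%N.
  rewrite -has_find; have [i il Ui] := hl x.
  by apply/(has_nthP 0); exists i => //; apply/asboolP.
exists (size l), (fun x => Ordinal (hlt x)) => x y; split=> [[e]|h].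
  have hx := nth_find 0 (etrans (has_find (fun z => `[< U (x - z) >]) l) (hlt x)).
  have hy := nth_find 0 (etrans (has_find (fun z => `[< U (y - z) >]) l) (hlt y)).
  move: hx; rewrite e => /asboolP hx; move/asboolP: hy => hy.
  by apply: (subgroup_trans gU hx); exact: subgroup_sym.
apply: val_inj => /=; apply: eq_find => z; apply/asboolP/asboolP.
  by apply: subgroup_trans => //; exact: subgroup_sym.
exact: subgroup_trans.
Qed.

(** Labels that are not attained are dropped, so that labels and cosets correspond one to one. *)
Lemma opensub_transversal U : opensub U ->
  exists (N : nat) (rep : 'I_N -> X) (lab : X -> 'I_N),
    [/\ (0 < N)%N, forall x y, lab x = lab y <-> U (x - y) & cancel rep lab].
Proof.
move=> oU; have gU := oU.2; have [k [lab labE]] := opensub_label oU.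
pose A := [set i : 'I_k | `[< exists x, lab x = i >]]%SET.
have labA x : lab x \in A by rewrite inE; apply/asboolP; exists x.
have /choice [rep hrep] : forall i : 'I_#|A|, exists x, lab x = enum_val i.
  by move=> i; have := enum_valP i; rewrite inE => /asboolP.
exists #|A|, rep, (fun x => enum_rank_in (labA 0) (lab x)); split.
- by apply/card_gt0P; exists (lab 0).
- move=> x y; rewrite -labE; split=> [/(congr1 enum_val)|-> //].
  by rewrite !enum_rankK_in.
- by move=> i; rewrite hrep enum_valK_in.
Qed.

Lemma opensub_index_pos U : opensub U ->
  exists2 k, (0 < k)%N & forall x, U (x *+ k).
Proof.
move=> oU; have gU := oU.2; have [k [lab labE]] := opensub_label oU.
(* Two of the multiples [x *+ i] with [i <= k] share a coset; the difference of their indices lies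
   between 1 and [k], hence divides the factorial. *)
exists k`!; first exact: fact_gt0.
move=> x.
have /injectivePn [i [j nij e]] : ~~ injectiveb (fun i : 'I_k.+1 => lab (x *+ i)).
  apply/negP => /injectiveP /(@leq_card _ _ _).
  by rewrite !card_ord ltnn.
wlog lij : i j nij e / (i < j)%N.
  move=> h; case: (ltngtP i j) => [lij|lij|eij]; first exact: (h i j).
    by apply: (h j i) => //; rewrite eq_sym.
  by move: nij; rewrite (val_inj eij) eqxx.
have Uij : U (x *+ (j - i)).
  by rewrite mulrnBr; [apply/labE; rewrite e|exact: ltnW].
have /dvdnP [c ->] : (j - i %| k`!)%N.
  apply: dvdn_fact; rewrite subn_gt0 lij /=.
  by rewrite leq_subLR (leq_trans _ (leq_addl _ _)) // -ltnS.
by rewrite mulnC mulrnA; apply: subgroupMn.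
Qed.

Hypothesis zX : zero_dimensional X.

Lemma zero_dim_hausdorff : hausdorff_space X.
Proof.
move=> x y cxy; apply: contrapT => /eqP nxy.
have [C [[oC cC] Cx nCy]] := zX nxy.
have [] := cxy C (~` C).
- exact: open_nbhs_nbhs.
- by apply: open_nbhs_nbhs; split => //; exact: closed_openC.
by move=> z [].
Qed.

(** Openness is a tube argument: near each [y] all small translations respect [D] or its complement,
    and compactness makes one size of translation do for all [y]. *)
Lemma opensub_stabilizer (D : set X) : clopen D ->
  opensub [set x | forall y, D y <-> D (x + y)].
Proof.
move=> [oD cD].
have gH : subgroup [set x | forall y, D y <-> D (x + y)].
  split=> [y|x y Hx Hy z]; first by rewrite add0r.
  rewrite (Hy (x - y + z)) addrA [y + _]addrC subrK; exact: Hx.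
split=> //; apply: subgroup_open => //.
have /compact_near_coveringP ncX := cX.
apply: filterS (ncX X (nbhs 0) (fun x y => D y <-> D (x + y)) _ _) => [x h y|y _]; first exact: h.
have cont (B : set X) : open B -> B y ->
    \forall y' \near y & x' \near 0, B y' /\ B (x' + y').
  move=> oB By; have : nbhs ((0 : X) + y) B by rewrite add0r; exact: open_nbhs_nbhs.
  move=> /(@add_continuous X (0, y)) [[P Q] /= [P0 Qy] PQ].
  exists (Q `&` B, P) => /=.
    by split=> //; apply: filterI => //; exact: open_nbhs_nbhs.
  by move=> [y' x'] /= [[Qy' By'] Px']; split => //; exact: (PQ (x', y')).
have [Dy|nDy] := pselect (D y).
  by apply: filterS (cont D oD Dy) => -[y' x'] /= [].
by apply: filterS (cont (~` D) (closed_openC cD) nDy) => -[y' x'] /= [].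
Qed.

(** A clopen neighbourhood of 0 contains its own stabiliser, because the stabiliser moves 0 inside
    it. *)
Lemma opensub_base O : nbhs 0 O -> exists2 U, opensub U & U `<=` O.
Proof.
move=> nO; have [D [D0 clD] DO] :=
  zero_dimensional_cvg zero_dim_hausdorff zX cX nO.
exists [set x | forall y, D y <-> D (x + y)]; first exact: opensub_stabilizer.
by move=> x Hx; apply: DO; rewrite /= -(addr0 x) -Hx.
Qed.

End TopologicalGroup.

(** * Characters *)

Section Integers.
Variable R : realType.
Implicit Types a b : R.

Lemma intval_int (z : int) : intval (z%:~R : R).
Proof. by exists z. Qed.

Lemma intval0 : intval (0 : R).
Proof. by exists 0. Qed.

Lemma intvalD a b : intval a -> intval b -> intval (a + b).
Proof. by move=> [x ->] [y ->]; exists (x + y); rewrite intrD. Qed.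

Lemma intvalN a : intval a -> intval (- a).
Proof. by move=> [x ->]; exists (- x); rewrite intrN. Qed.

Lemma intvalB a b : intval a -> intval b -> intval (a - b).
Proof. by move=> ha hb; apply: intvalD => //; exact: intvalN. Qed.

Lemma intvalM a b : intval a -> intval b -> intval (a * b).
Proof. by move=> [x ->] [y ->]; exists (x * y); rewrite intrM. Qed.

Lemma intval_sum (I : Type) (r : seq I) (P : pred I) (F : I -> R) :
  (forall i, P i -> intval (F i)) -> intval (\sum_(i <- r | P i) F i).
Proof.
by move=> h; elim/big_ind: _ => //; [exact: intval0|exact: intvalD].
Qed.

End Integers.

(** * Homomorphisms to R/Z and their extension *)

Section QuasiAdditive.
Variables (R : realType) (V : zmodType).
Implicit Types (H : set V) (c : V -> R).

(** A homomorphism from [H] to R/Z given by a real lift; off [H] the values are unconstrained. *)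
Definition add_mod1 H c : Prop :=
  forall x y, H x -> H y -> intval (c (x + y) - c x - c y).

Lemma add_mod1_0 H c : subgroup H -> add_mod1 H c -> intval (c 0).
Proof.
move=> gH h; have := h 0 0 (subgroup0 gH) (subgroup0 gH).
by rewrite addr0 subrr sub0r => /intvalN; rewrite opprK.
Qed.

Lemma add_mod1N H c x : subgroup H -> add_mod1 H c -> H x ->
  intval (c (- x) + c x).
Proof.
move=> gH h Hx; have := h (- x) x (subgroupN gH Hx) Hx.
rewrite addNr => h2.
rewrite (_ : _ + _ = c 0 - (c 0 - c (- x) - c x)); last by ring.
by apply: intvalB => //; exact: add_mod1_0 h.
Qed.

Lemma add_mod1Mn H c x (n : nat) : subgroup H -> add_mod1 H c -> H x ->
  intval (c (x *+ n) - n%:R * c x).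
Proof.
move=> gH h Hx; elim: n => [|n IH].
  by rewrite mulr0n mul0r subr0; exact: add_mod1_0 h.
rewrite mulrS -(addn1 n) natrD.
rewrite (_ : _ - _ = (c (x + x *+ n) - c x - c (x *+ n)) + (c (x *+ n) - n%:R * c x)).
  by apply: intvalD => //; apply: h => //; exact: subgroupMn.
by ring.
Qed.

Lemma add_mod1Mz H c x (n : int) : subgroup H -> add_mod1 H c -> H x ->
  intval (c (x *~ n) - n%:~R * c x).
Proof.
move=> gH h Hx; case: n => n; first exact: add_mod1Mn h Hx.
rewrite NegzE mulrNz intrN mulNr opprK.
rewrite (_ : _ + _ = (c (- (x *+ n.+1)) + c (x *+ n.+1)) - (c (x *+ n.+1) - n.+1%:R * c x)).
  apply: intvalB; last exact: add_mod1Mn h Hx.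
  by apply: (add_mod1N gH) => //; exact: subgroupMn.
by rewrite pmulrn; ring.
Qed.

(** Divisibility of R/Z for one new generator: [m] is the order of [y] modulo [H], and a value [t]
    at [y] is admissible once [m t] agrees with [c] at [y *+ m]. *)
Lemma add_mod1_extend1 H c y (m : nat) (t : R) :
  subgroup H -> add_mod1 H c -> (0 < m)%N -> H (y *+ m) ->
  (forall k, (0 < k < m)%N -> ~ H (y *+ k)) ->
  intval (t * m%:R - c (y *+ m)) ->
  exists c', [/\ add_mod1 [set x | exists k : int, H (x - y *~ k)] c',
    forall x, H x -> intval (c' x - c x) & intval (c' y - t)].
Proof.
move=> gH hc m0 Hm min ht.
(* Well-definedness: by minimality of [m], a multiple of [y] in [H] is a multiple of [y *+ m]. *)
have key (k : int) : H (y *~ k) -> intval (c (y *~ k) - k%:~R * t).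
  move=> Hk; have km : (m%:Z %| k)%Z.
    apply/dvdz_mod0P.
    have mn0 : m%:Z != 0 by rewrite eqz_nat -lt0n.
    have : H (y *~ (k %% m)%Z).
      have -> : y *~ (k %% m)%Z = y *~ k - y *+ m *~ (k %/ m)%Z.
        by rewrite pmulrn -mulrzA -mulrzBr; congr (_ *~ _); have := divz_eq k m%:Z;
          move: (_ %/ _)%Z (_ %% _)%Z => u v ->; ring.
      by apply: subgroupB => //; exact: subgroupMz.
    have := ltz_mod k mn0; have := modz_ge0 k mn0.
    case: (k %% m)%Z => // r _ rm; have {}rm : (r < m)%N by move: rm; lia.
    by case: (posnP r) => [->//|r0] /(min r); rewrite r0 rm => /(_ isT).
  have [j kE] := dvdzP km.
  have -> : y *~ k = y *+ m *~ j by rewrite kE mulrC mulrzA.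
  rewrite (_ : _ - _ = (c (y *+ m *~ j) - j%:~R * c (y *+ m))
     - j%:~R * (t * m%:R - c (y *+ m))).
    apply: intvalB; first exact: add_mod1Mz hc Hm.
    by apply: intvalM => //; exact: intval_int.
  by rewrite kE intrM -[m%:~R]/(m%:R); ring.
pose H' := [set x | exists k : int, H (x - y *~ k)].
have /choice [k hk] : forall x, exists k : int, H' x -> H (x - y *~ k).
  by move=> x; have [[k hk]|n] := pselect (H' x); [exists k|exists 0].
pose c' x := c (x - y *~ k x) + (k x)%:~R * t.
have c'E x (j : int) : H (x - y *~ j) -> intval (c' x - (c (x - y *~ j) + j%:~R * t)).
  move=> Hj; have Hk : H (x - y *~ k x) by apply: hk; exists j.
  have e : x - y *~ k x = (x - y *~ j) + y *~ (j - k x).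
    by rewrite mulrzBr addrA subrK.
  have Hjk : H (y *~ (j - k x)).
    by rewrite -(subgroupDl _ gH Hj) -e.
  rewrite /c' (_ : _ - _ = (c (x - y *~ k x) - c (x - y *~ j) - c (y *~ (j - k x)))
     + (c (y *~ (j - k x)) - (j - k x)%:~R * t)).
    apply: intvalD; last exact: key.
    by rewrite e; apply: hc.
  by rewrite intrB; ring.
exists c'; split.
- move=> x1 x2 [k1 h1] [k2 h2].
  have e : x1 + x2 - y *~ (k1 + k2) = (x1 - y *~ k1) + (x2 - y *~ k2).
    by rewrite mulrzDr opprD addrACA.
  have h12 : H (x1 + x2 - y *~ (k1 + k2)) by rewrite e; exact: subgroupD.
  rewrite (_ : _ - _ = (c' (x1 + x2) - (c (x1 + x2 - y *~ (k1 + k2)) + (k1 + k2)%:~R * t))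
    - (c' x1 - (c (x1 - y *~ k1) + k1%:~R * t)) - (c' x2 - (c (x2 - y *~ k2) + k2%:~R * t))
    + (c (x1 + x2 - y *~ (k1 + k2)) - c (x1 - y *~ k1) - c (x2 - y *~ k2))).
    apply: intvalD; last by rewrite e; exact: hc.
    by apply: intvalB; [apply: intvalB|]; exact: c'E.
  by rewrite intrD; ring.
- move=> x Hx; have := @c'E x 0; rewrite mulr0z subr0 mul0r addr0; exact.
- have := @c'E y 1; rewrite mulr1z subrr mul1r => /(_ (subgroup0 gH)).
  move=> h; rewrite (_ : _ - _ = (c' y - (c 0 + t)) + c 0); last by ring.
  by apply: intvalD => //; exact: add_mod1_0 hc.
Qed.

Lemma subgroup_adjoin H y : subgroup H ->
  subgroup [set x | exists k : int, H (x - y *~ k)].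
Proof.
move=> gH; split; first by exists 0; rewrite mulr0z subr0; exact: subgroup0.
move=> x1 x2 [k1 h1] [k2 h2]; exists (k1 - k2).
by rewrite mulrzBr opprD addrACA -opprD; exact: subgroupB.
Qed.

Lemma min_order H y : (exists2 k, (0 < k)%N & H (y *+ k)) ->
  exists m, [/\ (0 < m)%N, H (y *+ m) & forall k, (0 < k < m)%N -> ~ H (y *+ k)].
Proof.
move=> [k0 k00 Hk0].
have ex : exists k, (0 < k)%N && `[< H (y *+ k) >].
  by exists k0; rewrite k00; apply/asboolP.
case: (ex_minnP ex) => m /andP[m0 /asboolP Hm] min; exists m; split=> // k /andP[k1 km] Hk.
by have := min k; rewrite k1 leqNgt km => /(_ (asboolT Hk)).
Qed.

(** A finite list is enough for reaching all of [X]: it will represent the cosets of an open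
    subgroup. *)
Lemma add_mod1_extend H c (l : seq V) : subgroup H -> add_mod1 H c ->
  (forall x, exists2 k, (0 < k)%N & H (x *+ k)) ->
  exists H' c', [/\ subgroup H', add_mod1 H' c', H `<=` H',
    (forall x, x \in l -> H' x) & forall x, H x -> intval (c' x - c x)].
Proof.
move=> + + tor; elim: l H c tor => [|y l IH] H c tor gH hc.
  by exists H, c; split=> // x _; rewrite subrr; exact: intval0.
have [m [m0 Hm min]] := min_order (tor y).
have [|c1 [hc1 e1 _]] := @add_mod1_extend1 H c y m (c (y *+ m) / m%:R) gH hc m0 Hm min.
  by rewrite divfK ?pnatr_eq0 -?lt0n // subrr; exact: intval0.
set H1 := mkset _ in hc1.
have HH1 : H `<=` H1 by move=> x Hx; exists 0; rewrite mulr0z subr0.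
have tor1 x : exists2 k, (0 < k)%N & H1 (x *+ k).
  by have [k k0 Hk] := tor x; exists k => //; exact: HH1.
have [H2 [c2 [gH2 hc2 H12 lH2 e2]]] := IH H1 c1 tor1 (subgroup_adjoin y gH) hc1.
exists H2, c2; split=> //.
- by move=> x Hx; apply: H12; exact: HH1.
- move=> x; rewrite inE => /predU1P[->|/lH2//].
  by apply: H12; exists 1; rewrite mulr1z subrr; exact: subgroup0.
- move=> x Hx; rewrite (_ : _ - _ = (c2 x - c1 x) + (c1 x - c x)); last by ring.
  by apply: intvalD; [apply: e2; exact: HH1|exact: e1].
Qed.

End QuasiAdditive.

(** * Separation of points by characters *)

Section Characters.
Variables (R : realType) (X : topologicalZmodType).
Implicit Types (c : X -> R) (U : set X).

Lemma sincos_intval (a b : R) : intval (a - b) ->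
  cos (2 * pi * a) = cos (2 * pi * b) /\ sin (2 * pi * a) = sin (2 * pi * b).
Proof.
have pos (n : nat) (u : R) : cos (u + 2 * pi * n%:R) = cos u /\ sin (u + 2 * pi * n%:R) = sin u.
  elim: n => [|n [IHc IHs]]; first by rewrite mulr0 addr0.
  rewrite -(addn1 n) natrD mulrDr mulr1 addrA.
  have e2 : 2 * pi = pi *+ 2 :> R by rewrite mulr_natl.
  by rewrite [X in _ + X]e2 cosD2pi sinD2pi.
move=> [[n|n]] e.
  have -> : 2 * pi * a = 2 * pi * b + 2 * pi * n%:R.
    by rewrite -mulrDr -(subrK b a) e addrC pmulrn.
  exact: pos.
have -> : 2 * pi * b = 2 * pi * a + 2 * pi * n.+1%:R.
  rewrite -mulrDr; congr (_ * _); apply/eqP; rewrite eq_sym -subr_eq0 addrAC e NegzE intrN.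
  by rewrite -pmulrn addNr.
by have [-> ->] := pos n.+1 (2 * pi * a).
Qed.

Lemma is_char_add c : is_char c -> add_mod1 setT c.
Proof. by case=> h _ x y _ _. Qed.

Lemma is_char_locally_const c U : opensub U -> add_mod1 setT c ->
  (forall u, U u -> intval (c u)) -> is_char c.
Proof.
move=> oU hc hU; split; first by move=> x y; exact: hc.
have near_eq x : \forall y \near x, intval (c y - c x).
  have : nbhs x [set y | U (y - x)].
    apply: open_nbhs_nbhs; split; first exact: opensub_coset_open.
    by rewrite /= subrr; exact: subgroup0 oU.2.
  apply: filterS => y /hU h; have := hc (y - x) x Logic.I Logic.I.
  rewrite subrK => h'.
  by rewrite (_ : _ - _ = (c y - c (y - x) - c x) + c (y - x)); [exact: intvalD|ring].
by split=> x A /nbhs_singleton Ax; apply: filterS (near_eq x) => y /= /sincos_intval[e1 e2];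
  rewrite /preimage /= ?e1 ?e2.
Qed.

Hypothesis cX : compact [set: X].

(** The character is 0 on [U] and 1/m at [x0], with [m > 1] the order of [x0] modulo [U]; it is then
    extended over representatives of the cosets of [U]. *)
Lemma char_separation U (x0 : X) : opensub U -> ~ U x0 ->
  exists c, [/\ is_char c, (forall u, U u -> intval (c u)) & ~ intval (c x0)].
Proof.
move=> oU nU; have gU := oU.2.
have [k0 k00 hk0] := opensub_index_pos cX oU.
have tor x : exists2 k, (0 < k)%N & U (x *+ k) by exists k0.
have [m [m0 Um min]] := min_order (tor x0).
have m1 : (1 < m)%N.
  by rewrite ltn_neqAle m0 andbT; apply: contra_notN nU => /eqP m1; rewrite -m1 in Um.
have hc0 : add_mod1 U (fun=> 0 : R) by move=> x y _ _; rewrite !subr0; exact: intval0.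
have [|c1 [hc1 e1 et]] := @add_mod1_extend1 _ _ U _ x0 m (m%:R^-1) gU hc0 m0 Um min.
  by rewrite mulVf ?pnatr_eq0 -?lt0n // subr0; exists 1.
set H1 := mkset _ in hc1.
have UH1 : U `<=` H1 by move=> x Ux; exists 0; rewrite mulr0z subr0.
have H1x0 : H1 x0 by exists 1; rewrite mulr1z subrr; exact: subgroup0.
have tor1 x : exists2 k, (0 < k)%N & H1 (x *+ k).
  by have [k k1 Hk] := tor x; exists k => //; exact: UH1.
have [l hl] := opensub_cosets cX oU.
have [H2 [c2 [gH2 hc2 H12 lH2 e2]]] := add_mod1_extend l (subgroup_adjoin x0 gU) hc1 tor1.
have H2T x : H2 x.
  have [i il Ui] := hl x; rewrite -(subrK (nth 0 l i) x); apply: subgroupD => //.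
    by apply: H12; exact: UH1.
  by apply: lH2; exact: mem_nth.
have c2U u : U u -> intval (c2 u).
  move=> Uu; rewrite (_ : c2 u = (c2 u - c1 u) + (c1 u - 0)); last by ring.
  by apply: intvalD; [apply: e2; exact: UH1|exact: e1].
exists c2; split=> //.
  by apply: (is_char_locally_const oU) => // x y _ _; exact: hc2.
move=> h; have : intval (m%:R^-1 : R).
  rewrite (_ : m%:R^-1 = c2 x0 - (c2 x0 - c1 x0) - (c1 x0 - m%:R^-1)); last by ring.
  by apply: intvalB => //; apply: intvalB => //; exact: e2.
move=> [z ez]; have z0 : 0 < z by rewrite -(ltr0z R) -ez invr_gt0 ltr0n.
have : (1 : R) <= z%:~R by rewrite ler1z; lia.
by rewrite -ez invf_ge1 ?ltr0n // lern1 leqNgt m1.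
Qed.

End Characters.

(** * The descending chain condition *)

Section CharacterModule.
Variables (R : realType) (X : topologicalZmodType).
Implicit Types c : X -> R.

Lemma is_char0 : is_char (fun _ : X => 0 : R).
Proof.
split; first by move=> x y; rewrite !subr0; exact: intval0.
by split=> x; exact: cvg_cst.
Qed.

Lemma is_charD c c' : is_char c -> is_char c' -> is_char (fun x => c x + c' x).
Proof.
move=> [hc [cc sc]] [hc' [cc' sc']]; split.
  move=> x y; rewrite (_ : _ - _ = (c (x + y) - c x - c y) + (c' (x + y) - c' x - c' y)).
    exact: intvalD.
  by ring.
split=> x.
  rewrite (_ : (fun x => _) = fun x => cos (2 * pi * c x) * cos (2 * pi * c' x)
    - sin (2 * pi * c x) * sin (2 * pi * c' x)); last first.
    by apply/funext => y; rewrite mulrDr cosD.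
  by apply: cvgB; apply: cvgM; [exact: cc|exact: cc'|exact: sc|exact: sc'].
rewrite (_ : (fun x => _) = fun x => sin (2 * pi * c x) * cos (2 * pi * c' x)
    + cos (2 * pi * c x) * sin (2 * pi * c' x)); last first.
  by apply/funext => y; rewrite mulrDr sinD.
by apply: cvgD; apply: cvgM; [exact: sc|exact: cc'|exact: cc|exact: sc'].
Qed.

Lemma is_charN c : is_char c -> is_char (fun x => - c x).
Proof.
move=> [hc [cc sc]]; split.
  move=> x y; rewrite (_ : _ - _ = - (c (x + y) - c x - c y)).
    exact: intvalN.
  by ring.
split=> x.
  rewrite (_ : (fun x => _) = fun x => cos (2 * pi * c x)); first exact: cc.
  by apply/funext => y; rewrite mulrN cosN.
rewrite (_ : (fun x => _) = fun x => - sin (2 * pi * c x)); first by apply: cvgN; exact: sc.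
by apply/funext => y; rewrite mulrN sinN.
Qed.

Lemma is_charMz c (z : int) : is_char c -> is_char (fun x => z%:~R * c x).
Proof.
move=> hc.
have hn (n : nat) : is_char (fun x => n%:R * c x).
  elim: n => [|n IH].
    rewrite (_ : (fun x => _) = fun=> 0); first exact: is_char0.
    by apply/funext => x; rewrite mul0r.
  rewrite (_ : (fun x => _) = fun x => c x + n%:R * c x); first exact: is_charD.
  by apply/funext => x; rewrite -(addn1 n) natrD; ring.
case: z => n; first exact: hn.
rewrite (_ : (fun x => _) = fun x => - (n.+1%:R * c x)); first exact: is_charN.
by apply/funext => x; rewrite NegzE intrN -[n.+1%:~R]/(n.+1%:R); ring.
Qed.

Lemma is_char_comp c (f : X -> X) : is_char c -> continuous f ->
  (forall x y, f (x + y) = f x + f y) -> is_char (fun x => c (f x)).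
Proof.
move=> [hc [cc sc]] cf fD; split; first by move=> x y; rewrite fD.
split=> x.
  exact: (@continuous_comp _ _ _ f (fun x => cos (2 * pi * c x)) x (cf x) (cc (f x))).
exact: (@continuous_comp _ _ _ f (fun x => sin (2 * pi * c x)) x (cf x) (sc (f x))).
Qed.

End CharacterModule.

Lemma hausdorff_zero_dim_opensub (X : topologicalZmodType) (x : X) :
  compact [set: X] -> zero_dimensional X ->
  (forall U : set X, opensub U -> U x) -> x = 0.
Proof.
move=> cX zX h; apply: contrapT => /eqP; rewrite eq_sym => x0.
have [C [[oC cC] C0 nCx]] := zX _ _ x0.
have [U oU UC] := opensub_base cX zX (open_nbhs_nbhs (conj oC C0)).
by apply: nCx; apply: UC; exact: h.
Qed.

Lemma closed_sep_opensub (X : topologicalZmodType) (Z : set X) (x : X) :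
  compact [set: X] -> zero_dimensional X -> closed Z -> ~ Z x ->
  exists2 U : set X, opensub U & forall a, Z a -> ~ U (x - a).
Proof.
move=> cX zX cZ nZx.
have nb : nbhs 0 [set y | ~ Z (x + y)].
  by apply: (@nbhs0_translate _ x (~` Z)); apply: open_nbhs_nbhs; split=> //; exact: closed_openC.
have [U oU hU] := opensub_base cX zX nb.
exists U => // a Za Ua; apply: (hU (a - x)); first exact: subgroup_sym oU.2 Ua.
by rewrite addrC subrK.
Qed.

Lemma char_separation_closed (R : realType) (X : topologicalZmodType) (Z : set X) (x : X) :
  compact [set: X] -> zero_dimensional X -> closed Z -> subgroup Z -> ~ Z x ->
  exists c : X -> R, [/\ is_char c, (forall a, Z a -> intval (c a)) & ~ intval (c x)].
Proof.
move=> cX zX cZ gZ nZx.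
have [U oU hU] := closed_sep_opensub cX zX cZ nZx.
have oW := opensub_sumset oU gZ.
have [|c [hc cW nc]] := @char_separation R X cX _ x oW.
  by move=> [a Za Ua]; exact: (hU a).
exists c; split=> // a Za; apply: cW; exists a => //.
by rewrite subrr; exact: subgroup0 oU.2.
Qed.

Lemma opensub_chain (R : realType) (X : topologicalZmodType) :
  compact [set: X] -> zero_dimensional X -> metrizable R X ->
  exists U_ : nat -> set X, [/\ forall k, opensub (U_ k),
    forall k, U_ k.+1 `<=` U_ k & forall O, nbhs 0 O -> exists k, U_ k `<=` O].
Proof.
move=> cX zX [dist [d_ge0 d_eq0 d_sym d_tri d_open]].
have nball (k : nat) : nbhs 0 [set y | dist 0 y < k.+1%:R^-1].
  apply: open_nbhs_nbhs; split; last first.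
    by rewrite /= (d_eq0 0 0).2.
  apply/d_open => x /= hx; exists (k.+1%:R^-1 - dist 0 x); first by rewrite subr_gt0.
  move=> y /=; rewrite ltrBrDl; exact: le_lt_trans.
have /choice [V hV] : forall k, exists V, opensub V /\ V `<=` [set y | dist 0 y < k.+1%:R^-1].
  by move=> k; have [V oV VO] := opensub_base cX zX (nball k); exists V.
exists (fun k => [set x | forall i, (i < k)%N -> V i x]); split.
- by move=> k; apply: opensub_bigI => i; exact: (hV i).1.
- by move=> k x /= h i ik; apply: h; exact: leqW.
- move=> O; rewrite nbhsE => -[W [oW W0] WO]; move/d_open: oW => oW.
  have [r r0 hr] := oW _ W0.
  have [k hk] := ltr_add_invr r0.
  exists k.+1 => x /(_ k (ltnSn k)) /(hV k).2 /= hx; apply: WO; apply: hr => /=.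
  by apply: lt_trans hx _; rewrite add0r in hk.
Qed.

Section Noetherian.
Variables (R : realType) (d : nat) (X : topologicalZmodType).
Variable alpha : 'rV[int]_d -> X -> X.
Hypothesis acta : is_action alpha.
Hypothesis cX : compact [set: X].
Hypothesis zX : zero_dimensional X.

Lemma alpha0 x : alpha 0 x = x. Proof. by case: acta. Qed.
Lemma alphaD m n x : alpha (m + n) x = alpha m (alpha n x).
Proof. by case: acta. Qed.
Lemma alpha_add n x y : alpha n (x + y) = alpha n x + alpha n y.
Proof. by case: acta. Qed.
Lemma alpha_cont n : continuous (alpha n). Proof. by case: acta. Qed.
Lemma alphaC m n x : alpha m (alpha n x) = alpha n (alpha m x).
Proof. by rewrite -!alphaD addrC. Qed.
Lemma alpha_zero n : alpha n 0 = 0.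
Proof. by apply: (addIr (alpha n 0)); rewrite -alpha_add !add0r. Qed.
Lemma alphaN n x : alpha n (- x) = - alpha n x.
Proof. by apply: (addrI (alpha n x)); rewrite -alpha_add !subrr alpha_zero. Qed.
Lemma alphaB n x y : alpha n (x - y) = alpha n x - alpha n y.
Proof. by rewrite alpha_add alphaN. Qed.
Lemma alphaMn n x k : alpha n (x *+ k) = alpha n x *+ k.
Proof.
by elim: k => [|k IH]; rewrite ?mulr0n ?alpha_zero // !mulrS alpha_add IH.
Qed.
Lemma alpha_sum n (I : Type) (r : seq I) (F : I -> X) :
  alpha n (\sum_(i <- r) F i) = \sum_(i <- r) alpha n (F i).
Proof.
by elim/big_rec2: _ => [|i x y _ <-]; rewrite ?alpha_zero ?alpha_add.
Qed.

Lemma alpha_opensub n U : opensub U -> opensub (alpha n @^-1` U).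
Proof. by move=> oU; apply: opensub_preim oU _ _; [exact: alpha_cont|exact: alpha_add]. Qed.

Lemma is_char_act (f : laurent d) (c : X -> R) : is_char c -> is_char (act alpha f c).
Proof.
move=> hc; elim: f => [|t f IH].
  rewrite (_ : act _ _ _ = fun=> 0); first exact: is_char0.
  by apply/funext => x; rewrite /act big_nil.
rewrite (_ : act _ _ _ = fun x => t.1%:~R * c (alpha t.2 x) + act alpha f c x).
  apply: is_charD => //; apply: (@is_charMz R X (fun x => c (alpha t.2 x))).
  by apply: is_char_comp => //; [exact: alpha_cont|exact: alpha_add].
by apply/funext => x; rewrite /act big_cons.
Qed.

Lemma submodule_annihilator (Z : set X) : (forall n x, Z x -> Z (alpha n x)) ->
  submodule alpha [set c | @is_char R X c /\ forall x, Z x -> intval (c x)].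
Proof.
move=> aZ; split.
- by move=> c [].
- by split; [exact: is_char0|move=> x _; exact: intval0].
- move=> c c' [hc cZ] [hc' cZ']; split; first exact: is_charD.
  by move=> x Zx; apply: intvalD; [exact: cZ|exact: cZ'].
- move=> f c [hc cZ]; split; first exact: is_char_act.
  move=> x Zx; apply: intval_sum => t _; apply: intvalM; first exact: intval_int.
  by apply: cZ; exact: aZ.
- move=> c c' [hc cZ] hc' e; split=> // x Zx.
  by rewrite -(subrK (c x) (c' x)); apply: intvalD; [exact: e|exact: cZ].
Qed.

Hypothesis noeth : noetherian R alpha.

(* Dual of the ascending chain condition, applied to the annihilators of the [Z k]. *)
Lemma closed_subgroup_dcc (Z : nat -> set X) :
  (forall k, closed (Z k)) -> (forall k, subgroup (Z k)) ->
  (forall k n x, Z k x -> Z k (alpha n x)) -> (forall k, Z k.+1 `<=` Z k) ->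
  exists K, forall k, (K <= k)%N -> Z k = Z K.
Proof.
move=> cZ gZ aZ dZ.
have [|K hK] := noeth (fun k => submodule_annihilator (aZ k)).
  by move=> k c [hc h]; split=> // x /dZ; exact: h.
exists K => k Kk; apply/seteqP; split.
  exact: decreasing_subset.
move=> x Zx; apply: contrapT => nZx.
have [c [hc cZk nc]] := char_separation_closed R cX zX (cZ k) (gZ k) nZx.
have : [set c | @is_char R X c /\ forall x, Z k x -> intval (c x)] c by [].
by rewrite hK // => -[_ /(_ x Zx)].
Qed.

Lemma Mn_continuous (n : nat) : continuous (fun x : X => x *+ n).
Proof.
elim: n => [|n IH] x; first exact: cvg_cst.
rewrite (_ : (fun x => _) = fun x => x + x *+ n); last by apply/funext => y; rewrite mulrS.
apply: (@continuous_comp _ _ _ (fun y => (y, y *+ n)) (fun z : X * X => z.1 + z.2)).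
  by apply: cvg_pair => /=; [exact: cvg_id|exact: IH].
exact: add_continuous.
Qed.

Lemma closed_image (f : X -> X) : continuous f -> closed (range f).
Proof.
move=> cf; apply: compact_closed; first exact: zero_dim_hausdorff zX.
by apply: continuous_compact => //; apply: continuous_subspaceT.
Qed.

Lemma subgroup_range (f : X -> X) : (forall x y, f (x - y) = f x - f y) ->
  subgroup (range f).
Proof.
move=> fB; split; first by exists 0 => //; have := fB 0 0; rewrite !subrr.
by move=> _ _ [x _ <-] [y _ <-]; exists (x - y); rewrite ?fB.
Qed.

(** The subgroups k! X stabilise. The stable one lies in every open subgroup, because the exponent
    of the finite quotient divides some later factorial; hence it is trivial. *)
Lemma bounded_exponent : exists2 m, (0 < m)%N & forall x : X, x *+ m = 0.
Proof.
have [||||K hK] := @closed_subgroup_dcc (fun k => range (fun x : X => x *+ k`!)).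
- by move=> k; apply: closed_image; exact: Mn_continuous.
- by move=> k; apply: subgroup_range => x y; rewrite mulrnBl.
- by move=> k n _ [x _ <-]; exists (alpha n x) => //; rewrite alphaMn.
- move=> k _ [x _ <-]; exists (x *+ k.+1) => //.
  by rewrite -mulrnA factS.
exists K`!; first exact: fact_gt0.
move=> x; apply: hausdorff_zero_dim_opensub => // U oU.
have [k k0 kU] := opensub_index_pos cX oU.
have : range (fun x : X => x *+ K`!) (x *+ K`!) by exists x.
rewrite -(hK (maxn K k)) ?leq_maxl // => -[y _ <-].
have /dvdnP [j ->] : (k %| (maxn K k)`!)%N by apply: dvdn_fact; rewrite k0 leq_maxr.
by rewrite mulnC mulrnA; apply: subgroupMn => //; exact: oU.2.
Qed.

Hypothesis mX : metrizable R X.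

(* Dually: the p-torsion submodule of the dual is finitely generated. *)
Lemma cogenerating_opensub (p : nat) : exists U : set X,
  [/\ opensub U, forall x, U (x *+ p) &
      forall x, (forall n, U (alpha n x)) -> exists y, x = y *+ p].
Proof.
have [U_ [oU dU bU]] := opensub_chain cX zX mX.
pose P := range (fun x : X => x *+ p).
have gP : subgroup P by apply: subgroup_range => x y; rewrite mulrnBl.
have cP : closed P by apply: closed_image; exact: Mn_continuous.
pose W k := [set x | exists2 a, P a & U_ k (x - a)].
have oW k : opensub (W k) by exact: opensub_sumset.
(* The invariant parts of the [W k] are closed and decrease, with intersection inside [P]; by the
   chain condition one of them already lies in [P]. *)
have [||||K hK] := @closed_subgroup_dcc (fun k => [set x | forall n, W k (alpha n x)]).
- move=> k; rewrite (_ : mkset _ = \bigcap_n (alpha n @^-1` W k)).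
    by apply: closed_bigI => n _; exact: (opensub_clopen (alpha_opensub n (oW k))).2.
  by apply/seteqP; split=> x h n; [move=> _; exact: h|exact: h].
- move=> k; have gW := (oW k).2; split=> [n|x y hx hy n].
    by rewrite alpha_zero; exact: subgroup0.
  by rewrite alphaB; exact: subgroupB.
- by move=> k n x h m; rewrite -alphaD; exact: h.
- by move=> k x h n; have [a Pa Ua] := h n; exists a => //; exact: dU.
exists (W K); split=> //.
  by move=> x; exists (x *+ p); [exists x|rewrite subrr; exact: subgroup0 (oU K).2].
move=> x hx; suff [y _ <-] : P x by exists y.
apply: contrapT => nPx.
have [U' oU' hU'] := closed_sep_opensub cX zX cP nPx.
have [k hk] := bU _ (opensub_nbhs oU').
have : [set x | forall n, W k (alpha n x)] x.
  have hx' : [set x | forall n, W K (alpha n x)] x by [].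
  case: (leqP K k) => [Kk|/ltnW kK]; first by rewrite hK.
  by move=> n; have [a Pa Ua] := hx n; exists a => //; exact: (decreasing_subset dU kK).
by move=> /(_ 0); rewrite alpha0 => -[a Pa /hk]; exact: hU'.
Qed.

End Noetherian.

(** * Associated primes *)

Section AssociatedPrimes.
Variables (R : realType) (d : nat) (X : topologicalZmodType).
Variable alpha : 'rV[int]_d -> X -> X.
Hypothesis acta : is_action alpha.
Implicit Types (f g h : laurent d) (c : X -> R).

Lemma act_lmul f g c : act alpha (lmul f g) c = act alpha f (act alpha g c).
Proof.
apply/funext => x; rewrite /act big_allpairs_dep /=; apply: eq_bigr => a _.
rewrite big_distrr /=; apply: eq_bigr => b _.
by rewrite intrM mulrA addrC (alphaD acta).
Qed.

Lemma actC f g c : act alpha f (act alpha g c) = act alpha g (act alpha f c).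
Proof.
apply/funext => x; rewrite /act.
under eq_bigr do rewrite big_distrr /=.
rewrite exchange_big /=; apply: eq_bigr => a _.
rewrite big_distrr /=; apply: eq_bigr => b _.
by rewrite mulrCA (alphaC acta).
Qed.

Lemma act_cat f g c : act alpha (f ++ g) c = fun x => act alpha f c x + act alpha g c x.
Proof. by apply/funext => x; rewrite /act big_cat. Qed.

Lemma actB f c c' : act alpha f (fun x => c x - c' x) =
  fun x => act alpha f c x - act alpha f c' x.
Proof.
apply/funext => x; rewrite /act -sumrB; apply: eq_bigr => t _.
by rewrite mulrBr.
Qed.

Lemma act1 c : act alpha [:: (1, 0)] c = c.
Proof.
by apply/funext => x; rewrite /act big_seq1 /= mul1r (alpha0 acta).
Qed.

Lemma zero_char_act f c : zero_char c -> zero_char (act alpha f c).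
Proof.
move=> zc x; apply: intval_sum => t _; apply: intvalM; first exact: intval_int.
exact: zc.
Qed.

Hypothesis noeth : noetherian R alpha.

(* Otherwise annihilators grow forever along [c i = F i . c], and so do the
   submodules [ann (c i) . c]. *)
Lemma exists_prime_annihilator c : is_char c -> ~ zero_char c ->
  exists f, ~ zero_char (act alpha f c) /\
    forall g h, zero_char (act alpha (lmul g h) (act alpha f c)) ->
      zero_char (act alpha g (act alpha f c)) \/ zero_char (act alpha h (act alpha f c)).
Proof.
move=> hc nc; apply: contrapT => no.
have step f : exists g, ~ zero_char (act alpha f c) ->
    ~ zero_char (act alpha g (act alpha f c)) /\ exists h,
      zero_char (act alpha h (act alpha g (act alpha f c))) /\
      ~ zero_char (act alpha h (act alpha f c)).
  have [z|nz] := pselect (zero_char (act alpha f c)); first by exists [::].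
  apply: contrapT => /forallNP no'; apply: no; exists f; split=> // g h zgh.
  apply: contrapT => /not_orP[ng nh]; apply: (no' h) => _; split=> //.
  by exists g; split=> //; rewrite -act_lmul.
have [G hG] := choice step.
pose F := fix F i := if i is i'.+1 then lmul (G (F i')) (F i') else [:: (1, 0)].
have nF i : ~ zero_char (act alpha (F i) c).
  by elim: i => [|i IH]; rewrite /= ?act1 // act_lmul; have [] := hG _ IH.
pose N i := [set c' | is_char c' /\ exists h,
  zero_char (act alpha h (act alpha (F i) c)) /\ zero_char (fun x => c' x - act alpha h c x)].
have sN i : submodule alpha (N i).
  split.
  - by move=> c' [].
  - split; first exact: is_char0.
    by exists [::]; split=> x; rewrite /act !big_nil ?subrr; exact: intval0.
  - move=> c1 c2 [hc1 [h1 [z1 e1]]] [hc2 [h2 [z2 e2]]]; split; first exact: is_charD.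
    exists (h1 ++ h2); rewrite !act_cat; split=> x; first exact: intvalD.
    by rewrite opprD addrACA; exact: intvalD.
  - move=> f c1 [hc1 [h1 [z1 e1]]]; split; first exact: is_char_act.
    exists (lmul f h1); rewrite !act_lmul; split; first exact: zero_char_act.
    by rewrite -actB; exact: zero_char_act.
  - move=> c1 c2 [hc1 [h1 [z1 e1]]] hc2 e; split=> //.
    exists h1; split=> // x; rewrite -(subrK (c1 x) (c2 x)) -addrA; exact: intvalD.
have [|K hK] := noeth sN.
  move=> i c' [hc' [h [z e]]]; split=> //; exists h; split=> //.
  by rewrite /= act_lmul actC; exact: zero_char_act.
have [_ [h [z nz]]] := hG _ (nF K).
have : N K.+1 (act alpha h c).
  split; first exact: is_char_act.
  exists h; split; first by rewrite /= act_lmul.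
  by move=> x; rewrite subrr; exact: intval0.
rewrite hK // => -[_ [h' [z' e]]]; apply: nz.
(* Multiplying the congruence between [h . c] and [h' . c] by [F K] turns the vanishing of [h'] on
   [F K . c] into that of [h]. *)
move=> x; have := zero_char_act (F K) e x; rewrite actB (actC _ h) (actC _ h').
by move=> e'; rewrite -(subrK (act alpha h' (act alpha (F K) c) x) (act _ _ _ x));
  apply: intvalD.
Qed.

Hypothesis cX : compact [set: X].
Hypothesis zX : zero_dimensional X.

(** A nonzero character trivial on pX is killed by p, and so are all its multiples under the Laurent
    ring, one of which has a prime annihilator. *)
Lemma in_Palpha_of_nondivisible (p : nat) (x : X) : prime p ->
  (forall y, x <> y *+ p) -> in_Palpha R alpha p.
Proof.
move=> pp nx; split=> //.
have cP : closed (range (fun x : X => x *+ p)).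
  by apply: closed_image => //; exact: Mn_continuous.
have gP : subgroup (range (fun x : X => x *+ p)).
  by apply: subgroup_range => y z; rewrite mulrnBl.
have [|c [hc cP0 ncx]] := char_separation_closed R cX zX cP gP (x := x).
  by move=> [y _ e]; exact: (nx y).
have [f [nf hf]] := exists_prime_annihilator hc (fun z => ncx (z x)).
exists (act alpha f c); split=> //; first exact: is_char_act.
rewrite actC; apply: zero_char_act => y; rewrite /act big_seq1 /= (alpha0 acta).
have := add_mod1Mn p (conj Logic.I (fun _ _ _ _ => Logic.I)) (is_char_add hc) (Logic.I : setT y).
move=> e; rewrite (_ : _ * _ = c (y *+ p) - (c (y *+ p) - p%:R * c y)).
  by apply: intvalB => //; apply: cP0; exists y.
by rewrite -[p%:~R]/(p%:R); ring.
Qed.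

(** If X were p-divisible, write m = p^v s with s prime to p, and x = p^v z. Then s x = m z = 0,
    which together with p x = 0 forces x = 0. *)
Lemma in_Palpha_of_torsion (p m : nat) (x : X) : prime p -> (0 < m)%N ->
  (forall y : X, y *+ m = 0) -> x *+ p = 0 -> x <> 0 -> in_Palpha R alpha p.
Proof.
move=> pp m0 mX px x0.
have [[y hy]|div] := pselect (exists y : X, forall z, y <> z *+ p).
  exact: in_Palpha_of_nondivisible hy.
have divk k (y : X) : exists z, y = z *+ (p ^ k).
  elim: k y => [|k IH] y; first by exists y; rewrite expn0 mulr1n.
  have [z ->] := IH y; apply: contrapT => /forallNP no.
  apply: div; exists z => w zw; apply: (no w).
  by rewrite zw -mulrnA expnS.
have [s ps ms] := pfactor_coprime pp m0.
have [z xz] := divk (logn p m) x.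
have sx : x *+ s = 0 by rewrite xz -mulrnA mulnC -ms mX.
by exfalso; apply: x0; exact: coprime_torsion_eq0 (prime_gt0 pp) ps px sx.
Qed.

End AssociatedPrimes.

(** * Haar measure and mixing *)

Section FiniteHaar.
Variables (R : realType) (X : topologicalZmodType).
Hypothesis cX : compact [set: X].

(** [r A] is the proportion of coset representatives of [U] lying in [A]. A translation permutes the
    cosets, whence the invariance for [U]-saturated sets. *)
Lemma opensub_frequency (U : set X) : opensub U ->
  exists r : set X -> R, [/\ forall A, 0 <= r A <= 1, r setT = 1,
    forall A B, A `&` B = set0 -> r (A `|` B) = r A + r B &
    forall A x, (forall y z, A y -> U (y - z) -> A z) ->
      r ((fun y => x + y) @` A) = r A].
Proof.
move=> oU; have gU := oU.2; have [N [rep [lab [N0 labE repK]]]] := opensub_transversal cX oU.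
pose n (A : set X) := (\sum_(i < N) `[< A (rep i) >])%N.
have nN A : (n A <= N)%N.
  rewrite -[X in (_ <= X)%N](card_ord N) -sum1_card; apply: leq_sum => i _.
  exact: leq_b1.
exists (fun A => (n A)%:R / N%:R); split.
- move=> A; rewrite divr_ge0 ?ler0n //= ler_pdivrMr ?ltr0n // mul1r ler_nat.
  exact: nN.
- have -> : n setT = N.
    rewrite -[RHS](card_ord N) -sum1_card; apply: eq_bigr => i _.
    by rewrite asboolT.
  by rewrite divff // pnatr_eq0 -lt0n.
- move=> A B AB; rewrite -mulrDl -natrD; congr (_%:R / _).
  rewrite /n -big_split; apply: eq_bigr => i _ /=.
  have [Ai|nAi] := pselect (A (rep i)).
    have nBi : ~ B (rep i) by move=> Bi; have : set0 (rep i) by rewrite -AB.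
    by rewrite (asboolT Ai) (asboolF nBi) asboolT //; left.
  rewrite (asboolF nAi) add0n; congr nat_of_bool; apply/asboolP/asboolP.
    by case.
  by right.
- move=> A x sat; congr (_%:R / _).
  pose s (i : 'I_N) := lab (rep i - x).
  have sI : injective s.
    move=> i j /labE; rewrite opprB addrA subrK => /labE.
    by rewrite !repK.
  rewrite /n [RHS](reindex_inj sI) /=; apply: eq_bigr => i _.
  have e : U (rep (s i) - (rep i - x)) by apply/labE; rewrite repK.
  congr nat_of_bool; apply/asboolP/asboolP.
    move=> [y Ay xy]; apply: (sat _ _ _ (subgroup_sym gU e)).
    by rewrite -xy addrC addKr.
  move=> Asi; exists (rep i - x); last by rewrite addrC subrK.
  exact: sat Asi e.
Qed.

Lemma ultra_bounded_cvg (G : set_system nat) (u : nat -> R) : UltraFilter G ->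
  (forall k, 0 <= u k <= 1) -> exists l : R, u @ G --> l.
Proof.
move=> UG hu.
have [|p [_ clp]] := @segment_compact R 0 1 (u @ G) _.
  by apply: (@filterE _ G) => k; rewrite /= in_itv /=; exact: hu.
exists p => V nV; have [//|nGV] := in_ultra_setVsetC (u @^-1` V) UG.
by have [z [h1 h2]] := clp (~` V) V nGV nV; exfalso; exact: h1.
Qed.

Hypothesis zX : zero_dimensional X.
Hypothesis mX : metrizable R X.

(** An ultrafilter limit of the frequencies along a base of open subgroups. A clopen set is
    saturated under every [U_ k] inside its stabiliser, so its frequency is eventually translation
    invariant. *)
Lemma invariant_mean : exists m : set X -> R, [/\ forall A, 0 <= m A, m setT = 1,
    forall A B, A `&` B = set0 -> m (A `|` B) = m A + m B &
    forall A x, clopen A -> m ((fun y => x + y) @` A) = m A].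
Proof.
have [U_ [oU dU bU]] := opensub_chain cX zX mX.
have /choice [r hr] := fun k => opensub_frequency (oU k).
have [G [UG subG]] := ultraFilterLemma (_ : ProperFilter (\oo : set_system nat)).
have /choice [m hm] : forall A, exists l : R, (fun k => r k A) @ G --> l.
  by move=> A; apply: ultra_bounded_cvg => k; have [h _ _ _] := hr k.
have eqm A (l : R) : (\forall k \near \oo, r k A = l) -> m A = l.
  move=> e; have h : (fun k => r k A) @ G --> l by apply: cvg_near_cst; exact: (subG _ e).
  exact: (cvg_unique _ (hm A) h).
exists m; split.
- move=> A; apply: (cvgr_to_ge (hm A)); apply: nearW => k.
  by have [h _ _ _] := hr k; have /andP[] := h A.
- by apply: eqm; apply: nearW => k; have [_ h _ _] := hr k.
- move=> A B AB; apply: (cvg_unique _ (hm (A `|` B))) => //.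
  rewrite (_ : (fun k => _) = fun k => r k A + r k B); first exact: cvgD.
  by apply/funext => k; have [_ _ h _] := hr k; exact: h.
- move=> A x clA; apply: (cvg_unique _ _ (hm A)) => //.
  have oS := opensub_stabilizer cX clA.
  have [k0 hk0] := bU _ (opensub_nbhs oS).
  have e : {near G, (fun k => r k ((fun y => x + y) @` A)) =1 (fun k => r k A)}.
    apply: subG; exists k0 => // k /= k0k; have [_ _ _ h] := hr k; apply: h.
    move=> y z Ay /(decreasing_subset dU k0k) /hk0 /= h'.
    by rewrite (h' z) subrK.
  exact: cvg_trans (near_eq_cvg e) (hm _).
Qed.
End FiniteHaar.

(* Synonym of [X] whose measurable sets are the clopen sets. *)
Definition clopen_algebra (X : topologicalZmodType) : Type := X.
HB.instance Definition _ (X : topologicalZmodType) := Choice.copy (clopen_algebra X) X.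
HB.instance Definition _ (X : topologicalZmodType) :=
  isPointed.Build (clopen_algebra X) (0 : X).

Lemma setU_closed_clopen (X : topologicalZmodType) : setU_closed (@clopen X).
Proof. by move=> A B hA hB; exact: clopenU. Qed.

Lemma setC_closed_clopen (X : topologicalZmodType) : setC_closed (@clopen X).
Proof. by move=> A [oA cA]; split; [exact: closed_openC|exact: open_closedC]. Qed.

HB.instance Definition _ (X : topologicalZmodType) :=
  @isAlgebraOfSets.Build default_measure_display (clopen_algebra X) (@clopen X)
    (@clopen0 X) (@setU_closed_clopen X) (@setC_closed_clopen X).

(** * Extension of the clopen mean to a Haar measure *)

Section ClopenContent.
Variables (R : realType) (X : topologicalZmodType).
Hypothesis cX : compact [set: X].
Variable m : set X -> R.
Hypothesis m_ge0 : forall A, 0 <= m A.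
Hypothesis mU : forall A B, A `&` B = set0 -> m (A `|` B) = m A + m B.

Definition clopen_content (A : set (clopen_algebra X)) : \bar R := (m A)%:E.

Let content_ge0 A : (0 <= clopen_content A)%E.
Proof. by rewrite /clopen_content lee_fin. Qed.

Lemma mean0 : m set0 = 0.
Proof.
have := mU (setI0 (set0 : set X)); rewrite setU0 => h.
by apply: (addIr (m set0)); rewrite -h add0r.
Qed.

Lemma mean_le A B : A `<=` B -> m A <= m B.
Proof.
move=> AB; rewrite -(setDUK AB) mU; first by rewrite lerDl.
by apply/seteqP; split=> // x [? []].
Qed.

Lemma mean_leU A B : m (A `|` B) <= m A + m B.
Proof.
have -> : A `|` B = A `|` (B `\` A).
  apply/seteqP; split=> x [Ax|Bx]; [by left| |by left|by right; case: Bx].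
  by have [Ax|nAx] := pselect (A x); [left|right].
rewrite mU; first by rewrite lerD2l; apply: mean_le => x [].
by apply/seteqP; split=> // x [? []].
Qed.

Let content_semi_additive : measure_function.semi_additive clopen_content.
Proof.
move=> F n _ tF _; rewrite /clopen_content.
elim: n => [|n IH]; first by rewrite !big_ord0 mean0.
rewrite !big_ord_recr /= mU ?EFinD ?IH // -bigcup_mkord.
apply/seteqP; split=> // x [[i /= ilt Fi] Fn].
have /(_ i n Logic.I Logic.I) e := tF.
by have := e (ex_intro _ x (conj Fi Fn)) => ein; rewrite ein ltnn in ilt.
Qed.

HB.instance Definition _ := isContent.Build _ (clopen_algebra X) R clopen_content
  content_ge0 content_semi_additive.

(** A clopen set is compact, so a countable clopen cover of it has a finite subcover and finite
    subadditivity is enough. *)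
Let content_sigma_subadditive : measurable_subset_sigma_subadditive clopen_content.
Proof.
move=> A F mF mA AF.
have cA : compact (A : set X) by apply: (subclosed_compact mA.2 cX).
have /compact_near_coveringP ncA := cA.
have [|n _ hn] := ncA nat \oo (fun n x => exists2 i, (i < n)%N & F i x) _.
  move=> x /AF [i _ Fi]; exists (F i, [set n | (i < n)%N]) => /=.
    by split; [apply: open_nbhs_nbhs; split=> //; exact: (mF i).1|exists i.+1].
  by move=> [y n] /= [Fy iln]; exists i.
have {}hn : A `<=` \bigcup_(i < n) F i.
  by move=> x Ax; have [i iln Fi] := hn n (leqnn n) x Ax; exists i.
apply: (@le_trans _ _ (\sum_(0 <= i < n) clopen_content (F i))%E); last first.
  by apply: nneseries_lim_ge => k _ _; exact: content_ge0.
rewrite big_mkord sumEFin lee_fin; apply: le_trans (mean_le hn) _.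
elim: n {hn} => [|n IH]; first by rewrite bigcup_mkord !big_ord0 mean0.
rewrite bigcup_mkord !big_ord_recr /= -bigcup_mkord.
by apply: le_trans (mean_leU _ _) _; rewrite lerD2r.
Qed.

HB.instance Definition _ := Content_SigmaSubAdditive_isMeasure.Build _ R (clopen_algebra X)
  clopen_content content_sigma_subadditive.

Hypothesis mI : forall A x, clopen A -> m ((fun y => x + y) @` A) = m A.
Hypothesis mT : m setT = 1.

Definition clopen_extension : set X -> \bar R := mu_ext clopen_content.

Lemma clopen_extension_clopen A : clopen A -> clopen_extension A = (m A)%:E.
Proof. by move=> clA; rewrite /clopen_extension measurable_mu_extE. Qed.

Lemma clopen_translate (A : set X) x : clopen A -> clopen ((fun y => x + y) @` A).
Proof.
move=> [oA cA]; rewrite (_ : _ @` _ = [set y | A (- x + y)]).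
  by split; [exact: open_translate|exact: closed_translate].
apply/seteqP; split=> y /=; first by move=> [z Az <-]; rewrite addKr.
by move=> h; exists (- x + y); rewrite ?addNKr ?addrA ?subrr ?add0r.
Qed.

(** Translation carries clopen covers to clopen covers of the same total mass, which settles the
    outer measure of every set at once. *)
Lemma clopen_extension_invariant (A : set X) x :
  clopen_extension ((fun y => x + y) @` A) = clopen_extension A.
Proof.
have le (B : set X) (y : X) :
    (clopen_extension ((fun z => y + z)%R @` B) <= clopen_extension B)%E.
  apply: le_ereal_inf_tmp => _ [F [mF BF] <-]; apply: ereal_inf_lbound.
  exists (fun k => (fun z => y + z) @` F k).
    split; first by move=> k; apply: clopen_translate; exact: (mF k).
    by move=> _ [z /BF [k _ Fz] <-]; exists k => //; exists z.
  by apply: eq_eseriesr => k _; rewrite /clopen_content mI //; exact: (mF k).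
apply/eqP; rewrite eq_le le /=.
have {1}-> : A = (fun y => - x + y) @` ((fun y => x + y) @` A); last exact: le.
apply/seteqP; split=> y /=.
  by move=> Ay; exists (x + y); [exists y|rewrite addKr].
by move=> [_ [z Az <-] <-]; rewrite addKr.
Qed.

Hypothesis zX : zero_dimensional X.
Hypothesis mX : metrizable R X.

(** An open set is the union over [k] of its largest [U_ k]-saturated subsets, which are clopen. *)
Lemma borel_clopen (A : set X) : borel A -> <<s @clopen X >> A.
Proof.
have sa : sigma_algebra setT <<s @clopen X >> by exact: smallest_sigma_algebra.
apply: smallest_sub => // O oO.
have [U_ [oU dU bU]] := opensub_chain cX zX mX.
have -> : O = \bigcup_k [set x | forall y, U_ k (y - x) -> O y].
  apply/seteqP; split=> [x Ox|x [k _ h]].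
    have [k hk] := bU _ (nbhs0_translate (open_nbhs_nbhs (conj oO Ox))).
    by exists k => // y /hk /=; rewrite addrC subrK.
  by apply: h; rewrite subrr; exact: subgroup0 (oU k).2.
have [_ _ h] := sa; apply: h => k; apply: sub_sigma_algebra.
apply: (saturated_clopen (oU k)) => x y h Uyx z Uzy; apply: h.
by have := subgroup_trans (oU k).2 Uzy Uyx.
Qed.

Lemma haar_clopen_extension : haar (fun A => fine (clopen_extension A)).
Proof.
pose nu : {measure set _ -> \bar R} := measure_extension clopen_content.
have nuE A : nu A = clopen_extension A by [].
have le1 (A : set X) : borel A -> clopen_extension A \is a fin_num.
  move=> _; rewrite ge0_fin_numE; last exact: mu_ext_ge0.
  apply: (@le_lt_trans _ _ (clopen_extension setT)); first exact: le_mu_ext.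
  by rewrite clopen_extension_clopen ?ltry //; exact: clopenT.
split.
- by move=> A _; apply: fine_ge0; exact: mu_ext_ge0.
- by rewrite clopen_extension_clopen ?mT //; exact: clopenT.
- move=> F bF tF.
  have mF k : @measurable _ (g_sigma_algebraType (@clopen X : set (set (clopen_algebra X)))) (F k).
    exact: borel_clopen.
  have bUF : borel (\bigcup_k F k).
    by have [_ _ h] : sigma_algebra setT (@borel X) := smallest_sigma_algebra _ _; exact: h.
  have := @measure_semi_sigma_additive _ _ _ nu F mF tF (borel_clopen bUF).
  rewrite nuE -(fineK (le1 _ bUF)) => /fine_cvg; apply: cvg_trans.
  apply: near_eq_cvg; apply: nearW => n /=.
  by rewrite big_mkord sum_fine // => i _; exact: le1.
- by move=> x A _; rewrite clopen_extension_invariant.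
Qed.

End ClopenContent.

Lemma haar_exists (R : realType) (X : topologicalZmodType) :
  compact [set: X] -> zero_dimensional X -> metrizable R X ->
  exists mu : set X -> R, haar mu /\
    forall U x, opensub U -> ~ U x -> 0 < mu U < 1.
Proof.
move=> cX zX mX; have [m [m0 mT mU mI]] := invariant_mean cX zX mX.
exists (fun A => fine (clopen_extension m A)).
split; first exact: haar_clopen_extension.
move=> U x oU nUx; have clU := opensub_clopen oU.
rewrite clopen_extension_clopen //=.
have mU0 : 0 < m U.
  rewrite lt_neqAle m0 andbT; apply/eqP => mU0.
  (* Finitely many translates of [U] cover [X], so [U] cannot have mass 0. *)
  have [l hl] := opensub_cosets cX oU.
  pose G i := (fun y => nth 0 l i + y) @` U.
  have mt : m (\bigcup_(i < size l) G i) = 0.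
    elim: (size l) => [|n IH]; first by rewrite bigcup_mkord big_ord0 (mean0 mU).
    apply/eqP; rewrite eq_le m0 andbT bigcup_mkord big_ord_recr /= -bigcup_mkord.
    by apply: le_trans (mean_leU m0 mU _ _) _; rewrite IH add0r /G mI // -mU0.
  have : [set: X] `<=` \bigcup_(i < size l) G i.
    move=> z _; have [i il Ui] := hl z; exists i => //.
    by exists (z - nth 0 l i); rewrite // addrC subrK.
  by move/(mean_le m0 mU); rewrite mt mT ler10.
rewrite mU0 /=.
(* [U] and its translate by [x] are disjoint and of equal mass, so [U] has mass at most 1/2. *)
have : m (U `|` (fun y => x + y) @` U) <= m setT by apply: (mean_le m0 mU).
rewrite mU; first by rewrite mI // mT; move: mU0; lra.
apply/seteqP; split=> // z [Uz [y Uy e]]; apply: nUx.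
by have := subgroupB oU.2 Uz Uy; rewrite -e addrK.
Qed.

Section Mixing.
Variables (R : realType) (d : nat) (X : topologicalZmodType).
Variable alpha : 'rV[int]_d -> X -> X.
Hypothesis acta : is_action alpha.
Hypothesis cX : compact [set: X].
Hypothesis zX : zero_dimensional X.
Hypothesis mX : metrizable R X.
Hypothesis mixa : mixing R alpha.

Lemma alpha_sub1_continuous n : continuous (fun x => alpha n x - x).
Proof.
move=> x; apply: (@continuous_comp _ _ _ (fun y => (alpha n y, - y)) (fun z : X * X => z.1 + z.2)).
  apply: cvg_pair => /=; first exact: alpha_cont.
  exact: opp_continuous.
exact: add_continuous.
Qed.

(* A proper open subgroup containing the image is invariant under all powers of
   [alpha n], against mixing. *)
Lemma mixing_surjective (n : 'rV[int]_d) : n != 0 -> forall x, exists y, alpha n y - y = x.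
Proof.
move=> n0 x; apply: contrapT => nx.
pose Z := range (fun y => alpha n y - y).
have cZ : closed Z by apply: closed_image => //; exact: alpha_sub1_continuous.
have gZ : subgroup Z.
  by apply: subgroup_range => y z; rewrite (alphaB acta) opprD addrACA -opprD.
have [|U oU hU] := closed_sep_opensub cX zX cZ (x := x).
  by move=> [y _ e]; apply: nx; exists y.
have oW := opensub_sumset oU gZ; set W := mkset _ in oW.
have nWx : ~ W x by move=> [a Za]; exact: hU.
have Wn y : W (alpha n y - y).
  by exists (alpha n y - y); [exists y|rewrite subrr; exact: subgroup0 oU.2].
have Wk k y : W (alpha (n *+ k) y - y).
  elim: k => [|k IH]; first by rewrite mulr0n (alpha0 acta) subrr; exact: subgroup0 oW.2.
  by rewrite mulrS (alphaD acta); exact: subgroup_trans oW.2 (Wn _) IH.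
have [mu [hmu mu01]] := haar_exists cX zX mX.
have /andP[W0 W1] := mu01 W x oW nWx.
have bW : borel W by apply: sub_sigma_algebra; exact: oW.1.
(* By invariance [W] meets its preimages in [W], so the correlation stays at [mu W], whereas mixing
   would bring it to the square of [mu W]; the gap serves as tolerance. *)
have eta0 : 0 < mu W - mu W * mu W by nra.
have [K hK] := mixa hmu bW bW eta0.
have [i ni0] : exists i, n ord0 i != 0.
  apply: contrapT => /forallNP h; move/eqP: n0; apply; apply/rowP => i.
  by rewrite mxE; apply/eqP; apply: contrapT => /negP; exact: h.
have := hK (n *+ K.+1) _.
have -> : W `&` alpha (n *+ K.+1) @^-1` W = W.
  apply/seteqP; split=> [y []//|y Wy]; split=> //=.
  by rewrite -(subrK y (alpha _ y)); apply: subgroupD oW.2 _ Wy; exact: Wk.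
rewrite ger0_norm ?(ltW eta0) // ltxx => h; suff : false by []; apply: h.
exists i; rewrite mulmxnE -mulr_natr abszM natz absz_nat.
by apply: leq_pmull; rewrite absz_gt0.
Qed.

End Mixing.

(** * Polynomials acting on abelian groups *)

Definition ring_action (A : nzRingType) (V : zmodType) (rho : A -> V -> V) : Prop :=
  [/\ forall a x y, rho a (x + y) = rho a x + rho a y,
      forall a b x, rho (a + b) x = rho a x + rho b x,
      forall a b x, rho (a * b) x = rho a (rho b x) &
      forall x, rho 1 x = x].

(** Evaluation of [q] at [T]. The result is again a ring action when [T] is additive and commutes
    with [rho], so the construction nests: Z, then Z[T_1], then Z[T_1][T_2]. *)
Definition poly_act (A : nzRingType) (V : zmodType) (rho : A -> V -> V) (T : V -> V)
    (q : {poly A}) (x : V) : V :=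
  \sum_(i < size q) rho q`_i (iter i T x).

Section RingActionTheory.
Variables (A : nzRingType) (V : zmodType) (rho : A -> V -> V).
Hypothesis hrho : ring_action rho.

Lemma ract0 x : rho 0 x = 0.
Proof. by case: hrho => _ h _ _; apply: (addIr (rho 0 x)); rewrite -h !add0r. Qed.

Lemma ract_zero a : rho a 0 = 0.
Proof. by case: hrho => h _ _ _; apply: (addIr (rho a 0)); rewrite -h !add0r. Qed.

Lemma ractN a x : rho (- a) x = - rho a x.
Proof.
by case: hrho => _ h _ _; apply: (addrI (rho a x)); rewrite -h !subrr ract0.
Qed.

Lemma ractB a x y : rho a (x - y) = rho a x - rho a y.
Proof.
case: hrho => h _ _ _; rewrite h; congr (_ + _).
by apply: (addrI (rho a y)); rewrite -h !subrr ract_zero.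
Qed.

Lemma ract_sum a (I : Type) (r : seq I) (P : pred I) (F : I -> V) :
  rho a (\sum_(i <- r | P i) F i) = \sum_(i <- r | P i) rho a (F i).
Proof.
case: hrho => h _ _ _.
by elim/big_rec2: _ => [|i x y _ <-]; [exact: ract_zero|rewrite h].
Qed.
End RingActionTheory.

Section PolyAct.
Variables (A : comNzRingType) (V : zmodType) (rho : A -> V -> V) (T : V -> V).
Hypothesis hrho : ring_action rho.
Hypothesis TD : forall x y, T (x + y) = T x + T y.
Hypothesis TA : forall a x, T (rho a x) = rho a (T x).

Local Notation act := (poly_act rho T).
Implicit Types (q r : {poly A}) (x y : V) (a : A).

Lemma iterD_add i x y : iter i T (x + y) = iter i T x + iter i T y.
Proof. by elim: i => //= i ->. Qed.

Lemma poly_act_wide q n x : (size q <= n)%N -> act q x = \sum_(i < n) rho q`_i (iter i T x).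
Proof.
move=> qn; rewrite /poly_act (big_ord_widen n (fun i => rho q`_i (iter i T x)) qn).
rewrite big_mkcond; apply: eq_bigr => i _; case: ltnP => // h.
by rewrite nth_default // (ract0 hrho).
Qed.

Lemma poly_act_add q x y : act q (x + y) = act q x + act q y.
Proof.
rewrite /poly_act -big_split; apply: eq_bigr => i _.
by rewrite iterD_add; case: hrho => ->.
Qed.

Lemma poly_actD q r x : act (q + r) x = act q x + act r x.
Proof.
pose n := maxn (size q) (size r).
rewrite (@poly_act_wide _ n) ?size_polyD // (@poly_act_wide q n) ?leq_maxl //.
rewrite (@poly_act_wide r n) ?leq_maxr // -big_split; apply: eq_bigr => i _.
by rewrite coefD; case: hrho => _ ->.
Qed.

Lemma poly_actC a x : act a%:P x = rho a x.
Proof.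
rewrite (@poly_act_wide _ 1) ?size_polyC_leq1 // big_ord_recl big_ord0 addr0.
by rewrite coefC.
Qed.

Lemma poly_act_mulX q x : act (q * 'X) x = act q (T x).
Proof.
rewrite (@poly_act_wide _ (size q).+1); last first.
  by rewrite (leq_trans (size_polyMleq _ _)) // size_polyX addn2.
rewrite big_ord_recl coefMX /= (ract0 hrho) add0r; apply: eq_bigr => i _.
by rewrite coefMX /= -iterSr.
Qed.

Lemma poly_act_T q x : act q (T x) = T (act q x).
Proof.
rewrite /poly_act.
have T0 : T 0 = 0 by apply: (addIr (T 0)); rewrite -TD !add0r.
have -> : T (\sum_(i < size q) rho q`_i (iter i T x)) =
    \sum_(i < size q) T (rho q`_i (iter i T x)).
  by elim/big_rec2: _ => [//|i y z _ <-]; rewrite TD.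
by apply: eq_bigr => i _; rewrite TA -iterS iterSr.
Qed.

Lemma poly_act_mulC a q x : act (a%:P * q) x = rho a (act q x).
Proof.
rewrite (@poly_act_wide _ (size q)); last by rewrite mul_polyC size_scale_leq.
rewrite (ract_sum hrho); apply: eq_bigr => i _.
by rewrite coefCM; case: hrho => _ _ ->.
Qed.

Lemma poly_actM q r x : act (q * r) x = act q (act r x).
Proof.
elim/poly_ind: q x => [|q a IH] x; first by rewrite mul0r /poly_act size_poly0 !big_ord0.
rewrite mulrDl mulrAC poly_actD poly_act_mulX IH poly_act_T poly_act_mulC.
by rewrite poly_actD poly_act_mulX poly_actC.
Qed.

Lemma poly_actX x : act 'X x = T x.
Proof. by rewrite -[X in act X]mul1r poly_act_mulX -[1]/(1%:P) poly_actC; case: hrho. Qed.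

Lemma ring_action_poly : ring_action act.
Proof.
split; [exact: poly_act_add|exact: poly_actD|exact: poly_actM|].
by move=> x; rewrite -[1]/(1%:P) poly_actC; case: hrho.
Qed.

Lemma poly_actXn i x : act 'X^i x = iter i T x.
Proof.
elim: i => [|i IH]; first by rewrite expr0; case: ring_action_poly.
by rewrite exprS poly_actM poly_actX IH.
Qed.

Lemma poly_act_comm (f : V -> V) q x : (forall x y, f (x + y) = f x + f y) ->
  (forall x, f (T x) = T (f x)) -> (forall a x, f (rho a x) = rho a (f x)) ->
  f (act q x) = act q (f x).
Proof.
move=> fD fT fA; rewrite /poly_act.
have f0 : f 0 = 0 by apply: (addIr (f 0)); rewrite -fD !add0r.
have -> : f (\sum_(i < size q) rho q`_i (iter i T x)) =
    \sum_(i < size q) f (rho q`_i (iter i T x)).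
  by elim/big_rec2: _ => [//|i y z _ <-]; rewrite fD.
apply: eq_bigr => i _; rewrite fA; congr rho.
by elim: (val i) => //= j <-.
Qed.

End PolyAct.

Lemma ring_action_int (V : zmodType) : ring_action (fun (z : int) (x : V) => x *~ z).
Proof.
split=> [z x y|a b x|a b x|x]; rewrite ?mulrzDl ?mulrzDr ?mulr1z //.
by rewrite mulrC mulrzA.
Qed.

(** * Reduction modulo p and integer lifts *)

Section LiftFp.
Variable p : nat.
Hypothesis pp : prime p.

Lemma pFp : p \in [pchar 'F_p].
Proof. exact: pchar_Fp. Qed.

Lemma intr_Fp_eq0 (z : int) : ((z%:~R : 'F_p) == 0) = (p%:Z %| z)%Z.
Proof.
case: z => n; first by rewrite -pmulrn -(dvdn_pcharf pFp).
by rewrite NegzE intrN oppr_eq0 -pmulrn -(dvdn_pcharf pFp) dvdzE abszN.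
Qed.

Definition lift_Fp (a : 'F_p) : int := (a : nat)%:Z.

Lemma lift_FpK (a : 'F_p) : (lift_Fp a)%:~R = a.
Proof. by rewrite /lift_Fp -pmulrn natr_Zp. Qed.

Local Notation red := (map_poly (intr : int -> 'F_p)).

Definition lift_poly_Fp (q : {poly 'F_p}) : {poly int} := \poly_(i < size q) lift_Fp q`_i.

Lemma lift_poly_FpK q : red (lift_poly_Fp q) = q.
Proof.
apply/polyP => i; rewrite coef_map coef_poly; case: ltnP => h; first exact: lift_FpK.
by rewrite nth_default.
Qed.

Lemma red_eq0 (q : {poly int}) : red q = 0 -> exists r, q = p%:Z *: r.
Proof.
move=> q0; exists (\poly_(i < size q) (q`_i %/ p)%Z); apply/polyP => i.
rewrite coefZ coef_poly; case: ltnP => h; last by rewrite nth_default // mulr0.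
have : (red q)`_i == 0 by rewrite q0 coef0.
by rewrite coef_map intr_Fp_eq0 mulrC => /divzK ->.
Qed.

(* Powers of ['X] repeat modulo [q]. *)
Lemma dvd_Xn_sub1 (q : {poly 'F_p}) : q != 0 ->
  exists a b, (0 < b)%N /\ (q %| 'X^a * ('X^b - 1))%R.
Proof.
move=> q0; pose n := (size q).-1.
pose f (i : 'I_(#|{: 'rV['F_p]_(size q)}|).+1) : 'rV['F_p]_(size q) := poly_rV ('X^i %% q).
have /injectivePn [i [j nij e]] : ~~ injectiveb f.
  by apply/negP => /injectiveP /(@leq_card _ _ _); rewrite card_ord ltnn.
wlog lij : i j nij e / (i < j)%N.
  move=> h; case: (ltngtP i j) => [lij|lij|eij]; first exact: (h i j).
    by apply: (h j i) => //; rewrite eq_sym.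
  by move: nij; rewrite (val_inj eij) eqxx.
have e' : 'X^i %% q = 'X^j %% q :> {poly 'F_p}.
  rewrite -[LHS](@poly_rV_K _ (size q)) ?(ltnW (ltn_modpN0 _ q0)) //.
  by rewrite -[RHS](@poly_rV_K _ (size q)) ?(ltnW (ltn_modpN0 _ q0)) //; congr rVpoly.
exists i, (j - i)%N; split; first by rewrite subn_gt0.
rewrite mulrBr mulr1 -exprD subnKC; last exact: ltnW.
by rewrite /dvdp modpD modpN e' subrr.
Qed.

Lemma lift_dvd_Xn_sub1 (q : {poly int}) : red q != 0 ->
  exists (Q r : {poly int}) (a b : nat), (0 < b)%N /\
    'X^a * ('X^b - 1) = q * Q + p%:Z *: r.
Proof.
move=> /dvd_Xn_sub1 [a [b [b0 /dvdpP [Q' e]]]].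
have [|r hr] := @red_eq0 ('X^a * ('X^b - 1) - q * lift_poly_Fp Q').
  by rewrite rmorphB !rmorphM rmorphB !rmorph1 /= !map_polyXn lift_poly_FpK e mulrC subrr.
by exists (lift_poly_Fp Q'), r, a, b; split=> //; rewrite -hr [RHS]addrC subrK.
Qed.

(** An additive subgroup over a prime field is a linear subspace, so the columns of the cokernel of
    its row space kill it; one of them is nonzero because the subspace is proper. *)
Lemma annihilating_vector (n : nat) (S : set 'rV['F_p]_n) (A : 'rV['F_p]_n) :
  subgroup S -> ~ S A -> exists2 b : 'cV['F_p]_n, b != 0 & forall s, S s -> s *m b = 0.
Proof.
move=> gS nSA; pose B := (\sum_(s : 'rV['F_p]_n | `[< S s >]) << s >>)%MS.
have sB s : S s -> (s <= B)%MS.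
  by move=> Ss; apply: (sumsmx_sup s); [exact: asboolT|rewrite genmxE].
have nAB : ~~ (A <= B)%MS.
  apply/negP => /sub_sumsmxP [u Au]; apply: nSA; rewrite Au.
  apply: subgroup_sum => // s /asboolP Ss.
  have /sub_rVP [a ->] : (u s *m << s >> <= s)%MS.
    by apply: submx_trans (submxMl _ _) _; rewrite genmxE.
  by rewrite -(natr_Zp a) scaler_nat; exact: subgroupMn.
have nz : cokermx B != 0.
  by apply: contra nAB => /eqP e; rewrite submxE e mulmx0.
have /matrix0Pn [i [j nij]] := nz.
exists (col j (cokermx B)).
  apply/eqP => /matrixP /(_ i 0) e; move/eqP: nij; apply.
  by move: e; rewrite [LHS]mxE [RHS]mxE.
by move=> s /sB; rewrite submxE => /eqP e; rewrite colE mulmxA e mul0mx.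
Qed.

End LiftFp.

(** * The p-primary part *)

Section PrimaryPart.
Variables (R : realType) (d : nat) (X : topologicalZmodType).
Variable alpha : 'rV[int]_d -> X -> X.
Hypothesis acta : is_action alpha.
Hypothesis alpha_surj : forall n : 'rV[int]_d, n != 0 -> forall x, exists y, alpha n y - y = x.
Variables (m p : nat).
Hypothesis m0 : (0 < m)%N.
Hypothesis mX0 : forall x : X, x *+ m = 0.
Hypothesis pp : prime p.

(* The exponent exceeds the [p]-adic valuation of [m] so that [primary] contains the
   [p]-torsion even when [p] does not divide [m]. *)
Definition primary : set X := [set y | y *+ p ^ (logn p m).+1 = 0].
Local Notation e := (logn p m).+1.
Local Notation Y := primary.

Lemma primary_subgroup : subgroup Y.
Proof.
by split; rewrite /primary /= ?mul0rn // => x y hx hy; rewrite mulrnBl hx hy subrr.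
Qed.

Lemma primary_alpha n y : Y y -> Y (alpha n y).
Proof. by rewrite /primary /= -(alphaMn acta) => ->; rewrite (alpha_zero acta). Qed.

Lemma primary_torsion y : y *+ p = 0 -> Y y.
Proof. by rewrite /primary /= expnS mulrnA => ->; rewrite mul0rn. Qed.

(** With m = p^v s and s prime to p, the Chinese remainder theorem gives t equal to 1 modulo p^(v+1)
    and to 0 modulo s; multiplication by t projects X onto its p-part. *)
Lemma primary_projection : exists t : nat, (forall x, Y (x *+ t)) /\ forall y, Y y -> y *+ t = y.
Proof.
have [s ps ms] := pfactor_coprime pp m0.
have cps : coprime (p ^ e) s by rewrite coprimeXl.
pose t := chinese (p ^ e) s 1 0.
have t1 : t = 1 %[mod p ^ e] by exact: chinese_modl.
have /dvdnP [u tu] : (s %| t)%N.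
  by rewrite /dvdn (chinese_modr cps) mod0n.
exists t; split=> [x|y Yy].
  rewrite /primary /= -mulrnA tu expnS (_ : _ * _ = m * (u * p))%N; last by rewrite [in RHS]ms; move: (p ^ _)%N => q; ring.
  by rewrite mulrnA mX0 mul0rn.
rewrite (divn_eq t (p ^ e)) t1 modn_small; last first.
  by rewrite (leq_trans (prime_gt1 pp)) // expnS leq_pmulr // expn_gt0 prime_gt0.
by rewrite mulrnDr mulnC mulrnA Yy mul0rn add0r.
Qed.

Definition zact (z : int) (x : X) : X := x *~ z.

Definition pact (n : 'rV[int]_d) : {poly int} -> X -> X := poly_act zact (alpha n).

Lemma ring_action_zact : ring_action zact.
Proof. exact: ring_action_int. Qed.

Lemma alphaMz n z x : alpha n (zact z x) = zact z (alpha n x).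
Proof.
by case: z => k; rewrite /zact ?NegzE ?mulrNz ?(alphaN acta) ?pmulrn (alphaMn acta).
Qed.

Lemma ring_action_pact n : ring_action (pact n).
Proof.
by apply: ring_action_poly; [exact: ring_action_zact|exact: (alpha_add acta)|exact: alphaMz].
Qed.

Lemma pact_alpha n n' q x : alpha n' (pact n q x) = pact n q (alpha n' x).
Proof.
apply: poly_act_comm; [exact: (alpha_add acta)|exact: alphaC|exact: alphaMz].
Qed.

Lemma pactMn n q x k : pact n q (x *+ k) = pact n q x *+ k.
Proof.
have [h _ _ _] := ring_action_pact n.
elim: k => [|k IH]; first by rewrite !mulr0n (ract_zero (ring_action_pact n)).
by rewrite !mulrS h IH.
Qed.

Lemma pact_primary n q y : Y y -> Y (pact n q y).
Proof. by rewrite /primary /= -pactMn => ->; rewrite (ract_zero (ring_action_pact n)). Qed.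

Lemma iter_alpha n i x : iter i (alpha n) x = alpha (n *+ i) x.
Proof.
elim: i => [|i IH]; first by rewrite mulr0n (alpha0 acta).
by rewrite iterS IH mulrS (alphaD acta).
Qed.

(** X^a acts invertibly, and X^b - 1 acts as [alpha (n *+ b) - 1], which is onto because [n *+ b] is
    nonzero; the preimage is then projected to [Y]. *)
Lemma primary_surj_Xn_sub1 n a b : n != 0 -> (0 < b)%N -> forall y, Y y ->
  exists2 z, Y z & pact n ('X^a * ('X^b - 1)) z = y.
Proof.
move=> n0 b0 y Yy; have [t [YT tY]] := primary_projection.
have nb0 : n *+ b != 0.
  apply: contra n0 => /eqP nb; apply/eqP/rowP => i.
  have := congr1 (fun M : 'rV_d => M ord0 i) nb.
  by rewrite mulmxnE !mxE => /eqP; rewrite mulrn_eq0 eqn0Ngt b0 => /eqP.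
have [z hz] := alpha_surj nb0 (alpha (- (n *+ a)) y).
exists (z *+ t) => //.
have [hD hDl hM h1] := ring_action_pact n.
have hA := poly_actXn ring_action_zact (alpha_add acta n) (alphaMz n).
rewrite pactMn hM hDl (ractN (ring_action_pact n)) h1 /pact !hA !iter_alpha hz.
by rewrite -(alphaD acta) subrr (alpha0 acta) tY.
Qed.

(** Some multiple of [q] is congruent to X^a (X^b - 1) modulo p, so [q] is onto up to multiples of
    p. Iterating pushes the error into p^e Y = 0. *)
Lemma primary_surj n (q : {poly int}) : n != 0 -> map_poly (intr : int -> 'F_p) q != 0 ->
  forall y, Y y -> exists2 z, Y z & pact n q z = y.
Proof.
move=> n0 /(lift_dvd_Xn_sub1 pp) [Q [r [a [b [b0 eq]]]]].
have [hD hDl hM h1] := ring_action_pact n.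
have step y : Y y -> exists z w, [/\ Y z, Y w & y = pact n q z + w *+ p].
  move=> Yy; have [z Yz <-] := primary_surj_Xn_sub1 a n0 b0 Yy.
  exists (pact n Q z), (pact n r z); split; try exact: pact_primary.
  rewrite eq hDl hM; congr (_ + _).
  by rewrite -mul_polyC hM; exact: (poly_actC (alpha n) ring_action_zact).
have iter_step j y : Y y -> exists z w, [/\ Y z, Y w & y = pact n q z + w *+ p ^ j].
  move=> Yy; elim: j => [|j [z [w [Yz Yw ->]]]].
    exists 0, y; split=> //; first exact: subgroup0 primary_subgroup.
    by rewrite (ract_zero (ring_action_pact n)) add0r.
  have [z' [w' [Yz' Yw' ->]]] := step _ Yw.
  exists (z + z' *+ p ^ j), w'; split=> //.
    by apply: subgroupD => //; [exact: primary_subgroup|apply: subgroupMn => //; exact: primary_subgroup].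
  by rewrite hD pactMn mulrnDl -mulrnA -expnS addrA.
move=> y Yy; have [z [w [Yz Yw ->]]] := iter_step e y Yy.
by exists z => //; rewrite Yw addr0.
Qed.

End PrimaryPart.

(** [C] is common to all [U]; only the threshold [n0] varies. Points with the same itinerary through
    the cosets of [U] are not separated, so [F] injects into the words of a subcover of the join. *)
Lemma entropy_injective_card (R : realType) (X : topologicalZmodType) (T : X -> X) :
  compact [set: X] -> finite_entropy R T ->
  exists2 C : R, 0 <= C & forall U : set X, opensub U -> exists n0, forall n, (n0 <= n)%N ->
    forall (F : finType) (phi : F -> X),
    (forall a b, (forall i, (i < n)%N -> U (iter i T (phi a) - iter i T (phi b))) -> a = b) ->
    ln (#|F|%:R : R) <= C * n%:R.
Proof.
move=> cX [C hC]; exists (Num.max C 0); first by rewrite le_max lexx orbT.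
move=> U oU; have gU := oU.2; have [l hl] := opensub_cosets cX oU.
pose cov := [seq [set x | U (x - y)] | y <- l].
have ocov : open_cover cov.
  split=> [i|x]; rewrite /cov size_map.
    by move=> il; rewrite (nth_map 0) //; exact: opensub_coset_open.
  by have [i il Ui] := hl x; exists i => //; rewrite (nth_map 0).
have [n0 _ hn0] := hC _ ocov; exists n0 => n nn0 F phi inj.
have [k hk [s [sk _ hs]]] := hn0 n nn0.
have /choice [w hw] : forall a, exists w, w \in s /\
    forall i, (i < n)%N -> nth set0 cov (nth 0%N w i) (iter i T (phi a)).
  by move=> a; have [w ws hw] := hs (phi a); exists w.
have hlt a : (index (w a) s < size s)%N by rewrite index_mem; case: (hw a).
have ginj : injective (fun a => Ordinal (hlt a)).
  move=> a b [eab]; apply: inj => i iln.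
  have ew : w a = w b.
    by rewrite -(nth_index [::] (hw a).1) eab nth_index //; case: (hw b).
  have := (hw b).2 i iln; have := (hw a).2 i iln; rewrite -ew.
  case: (ltnP (nth 0%N (w a) i) (size l)) => h; last by rewrite nth_default ?size_map.
  rewrite (nth_map 0) // => h1 h2.
  exact: subgroup_trans gU h1 (subgroup_sym gU h2).
have := leq_card _ ginj; rewrite card_ord => Fs.
case: (posnP #|F|) => [->|F0].
  by rewrite ln0 // mulr_ge0 // le_max lexx orbT.
apply: le_trans (_ : ln (k%:R) <= _).
  by rewrite ler_ln ?posrE ?ltr0n ?ler_nat ?(leq_trans Fs) // (leq_trans F0) // (leq_trans Fs).
apply: le_trans hk _; rewrite ler_wpM2r //.
by rewrite le_max lexx.
Qed.

(** * Algebraic relations from finite entropy *)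

Lemma sum_mxvec_index (V : nmodType) (m n : nat) (f : 'I_(m * n) -> V) :
  \sum_k f k = \sum_i \sum_j f (mxvec_index i j).
Proof.
by rewrite (reindex _ (curry_mxvec_bij m n)) pair_bigA; apply: eq_bigr => -[i j] _.
Qed.

Section Relation.
Variables (R : realType) (d : nat) (X : topologicalZmodType).
Variable alpha : 'rV[int]_d -> X -> X.
Hypothesis acta : is_action alpha.
Hypothesis cX : compact [set: X].
Variables n1 n2 : 'rV[int]_d.
Variable p : nat.
Hypothesis pp : prime p.

Definition bact : {poly {poly int}} -> X -> X := poly_act (pact alpha n1) (alpha n2).

Local Notation red := (map_poly (intr : int -> 'F_p)).
Local Notation red2 := (map_poly (map_poly (intr : int -> 'F_p))).
Implicit Types G : {poly {poly int}}.

Lemma ring_action_bact : ring_action bact.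
Proof.
apply: ring_action_poly; [exact: ring_action_pact|exact: (alpha_add acta)|].
by move=> a x; exact: pact_alpha.
Qed.

Lemma bact_alpha n G x : alpha n (bact G x) = bact G (alpha n x).
Proof.
apply: poly_act_comm; [exact: (alpha_add acta)|by move=> y; exact: alphaC|].
by move=> a y; exact: pact_alpha.
Qed.

Lemma bactMn G x k : bact G (x *+ k) = bact G x *+ k.
Proof.
have [h _ _ _] := ring_action_bact.
elim: k => [|k IH]; first by rewrite !mulr0n (ract_zero ring_action_bact).
by rewrite !mulrS h IH.
Qed.

Section Character.
Variables (v : X -> 'F_p) (U : set X).
Hypothesis vD : forall x y, v (x + y) = v x + v y.
Hypothesis oU : opensub U.
Hypothesis vU : forall x, U x -> v x = 0.
Hypothesis entropy : finite_entropy R (alpha n1).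

Let v0 : v 0 = 0. Proof. by apply: (addIr (v 0)); rewrite -vD !add0r. Qed.
Let vN x : v (- x) = - v x. Proof. by apply: (addrI (v x)); rewrite -vD !subrr v0. Qed.
Let vsum (I : Type) (r : seq I) (P : pred I) (F : I -> X) :
  v (\sum_(i <- r | P i) F i) = \sum_(i <- r | P i) v (F i).
Proof. by elim/big_rec2: _ => [//|i x y _ <-]; rewrite vD. Qed.
Let vMz z x : v (zact z x) = z%:~R * v x.
Proof.
have vMn k : v (x *+ k) = k%:R * v x.
  elim: k => [|k IH]; first by rewrite mulr0n v0 mul0r.
  by rewrite mulrS vD IH -[in RHS]add1n natrD mulrDl mul1r.
case: z => k; first exact: vMn.
by rewrite NegzE /zact mulrNz vN intrN mulNr; congr (- _); exact: vMn.
Qed.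

Definition pattern (N L : nat) (x : X) : 'M['F_p]_(N, L) :=
  \matrix_(i, j) v (alpha (n1 *+ i + n2 *+ j) x).

Lemma patternD N L x y : pattern N L (x + y) = pattern N L x + pattern N L y.
Proof. by apply/matrixP => i j; rewrite !mxE (alpha_add acta) vD. Qed.

(* Fewer than [p ^ (N * L)] patterns occur once [L ln p] exceeds the entropy. *)
Lemma missing_pattern : exists N L A, forall x, mxvec (pattern N.+1 L.+1 x) <> A.
Proof.
have [C C0 hC] := entropy_injective_card cX entropy.
have [L hL] : exists L : nat, C < L.+1%:R * ln (p%:R : R).
  have lp : 0 < ln (p%:R : R) by rewrite ln_gt0 // ltr1n prime_gt1.
  exists (Num.truncn (C / ln (p%:R))); rewrite -ltr_pdivrMr //.
  by rewrite truncnS_gt.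
pose W := [set x | forall j, (j < L.+1)%N -> (alpha (n2 *+ j) @^-1` U) x].
have oW : opensub W by apply: opensub_bigI => j; exact: (alpha_opensub acta).
have [N hN] := hC W oW; exists N, L; apply: contrapT => /forallNP all_patterns.
have /choice [phi hphi] : forall A, exists x, mxvec (pattern N.+1 L.+1 x) = A.
  by move=> A; apply: contrapT => /forallNP; exact: all_patterns.
have := hN N.+1 (leqnSn N) _ phi _.
have inj a b : (forall i, (i < N.+1)%N ->
    W (iter i (alpha n1) (phi a) - iter i (alpha n1) (phi b))) -> a = b.
  move=> h; rewrite -(hphi a) -(hphi b); congr mxvec; apply/matrixP => i j; rewrite !mxE.
  have := h i (ltn_ord i) j (ltn_ord j); rewrite /= => /vU.
  rewrite !(iter_alpha acta) (alphaB acta) -!(alphaD acta) vD vN => /eqP.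
  by rewrite subr_eq0 addrC => /eqP.
move=> /(_ inj); rewrite card_mx mul1n card_Fp // natrX lnXn ?ltr0n ?prime_gt0 //.
rewrite -[ln _ *+ _]mulr_natl natrM => h; have : (L.+1%:R : R) * ln (p%:R : R) <= C.
  by rewrite -(ler_pM2l (ltr0Sn R N)) mulrA (le_trans h) // mulrC.
by rewrite leNgt hL.
Qed.

(** The patterns form a proper subspace, killed by a nonzero linear form [b]; its entries, lifted to
    integers, are the coefficients of [G]. *)
Lemma relation_char : exists G, red2 G != 0 /\ forall x, v (bact G x) = 0.
Proof.
have [N [L [A hA]]] := missing_pattern.
have gS : subgroup (range (fun x => mxvec (pattern N.+1 L.+1 x))).
  have p0 : pattern N.+1 L.+1 0 = 0.
    by apply: (addIr (pattern N.+1 L.+1 0)); rewrite -patternD !add0r.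
  split; first by exists 0 => //; rewrite p0 linear0.
  move=> _ _ [x _ <-] [y _ <-]; exists (x - y) => //.
  rewrite -linearB /=; congr mxvec; apply: (addIr (pattern N.+1 L.+1 y)).
  by rewrite -patternD !subrK.
have [|b b0 hb] := annihilating_vector (A := A) gS.
  by move=> [x _ e]; exact: (hA x).
pose g (i j : nat) : 'F_p := b (mxvec_index (inord i : 'I_N.+1) (inord j : 'I_L.+1)) 0.
pose G : {poly {poly int}} := \poly_(j < L.+1) \poly_(i < N.+1) lift_Fp (g i j).
have GE (j : 'I_L.+1) : G`_j = \poly_(i < N.+1) lift_Fp (g i j) by rewrite coef_poly ltn_ord.
have gE (j : 'I_L.+1) (i : 'I_N.+1) : (\poly_(i < N.+1) lift_Fp (g i j))`_i = lift_Fp (g i j).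
  by rewrite coef_poly ltn_ord.
exists G; split.
  have [k [l bk]] : exists k l, b k l != 0 by apply/matrix0Pn.
  case/mxvec_indexP: k bk => i j bij.
  apply: contra bij => /eqP G0.
  have := congr1 (fun q : {poly {poly 'F_p}} => q`_j`_i) G0.
  rewrite !coef0 !coef_map GE gE /= lift_FpK //.
  by rewrite /g !inord_val ord1 => /eqP.
move=> x; rewrite /bact (poly_act_wide (alpha n2) (ring_action_pact acta n1) _ (size_poly _ _)).
rewrite vsum; have := hb _ (ex_intro2 _ _ x Logic.I erefl).
move=> /matrixP /(_ 0 0); rewrite !mxE => e; rewrite -[RHS]e.
rewrite sum_mxvec_index exchange_big /=; apply: eq_bigr => j _.
rewrite GE /pact (poly_act_wide (alpha n1) (ring_action_zact X) _ (size_poly _ _)).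
rewrite vsum; apply: eq_bigr => i _.
rewrite gE vMz lift_FpK // mxvecE mxE mulrC /g !inord_val.
by rewrite !(iter_alpha acta) (alphaD acta).
Qed.

End Character.
End Relation.

(** A character trivial on [U], hence on multiples of [p], takes values in (1/p)Z; [p] times it is
    an integer, well defined modulo [p] on classes modulo 1. *)
Lemma Fp_separation (R : realType) (X : topologicalZmodType) (p : nat) (U : set X) (x0 : X) :
  compact [set: X] -> prime p -> opensub U -> (forall x, U (x *+ p)) -> ~ U x0 ->
  exists v : X -> 'F_p, [/\ forall x y, v (x + y) = v x + v y,
    forall x, U x -> v x = 0 & v x0 != 0].
Proof.
move=> cX pp oU pU nU.
have [c [hc cU nc]] := char_separation R cX oU nU.
have cadd := is_char_add hc.
have pc x : exists k : int, p%:R * c x = k%:~R.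
  rewrite (_ : _ * _ = c (x *+ p) - (c (x *+ p) - p%:R * c x)); last by ring.
  apply: intvalB; first exact: cU.
  by apply: (add_mod1Mn p _ cadd).
have /choice [k hk] := pc.
have p0 : (p%:R : R) != 0 by rewrite pnatr_eq0 -lt0n prime_gt0.
have kE x (z : int) : c x = z%:~R -> k x = p%:Z * z.
  by move=> e; apply: (@intr_inj R); rewrite -hk e intrM.
exists (fun x => (k x)%:~R); split.
- move=> x y; have [z ez] := cadd x y Logic.I Logic.I.
  have -> : k (x + y) = k x + k y + p%:Z * z.
    apply: (@intr_inj R); rewrite !intrD intrM -!hk -ez -[p%:~R]/(p%:R); ring.
  by rewrite !intrD intrM -pmulrn (pcharf0 (pFp pp)) mul0r addr0.
- move=> x /cU [z /kE ->].
  by rewrite intrM -pmulrn (pcharf0 (pFp pp)) mul0r.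
- rewrite intr_Fp_eq0 //; apply/negP => /dvdzP [z kz]; apply: nc; exists z.
  by apply: (mulfI p0); rewrite hk kz intrM mulrC.
Qed.

Section NormalRelation.
Variables (R : realType) (d : nat) (X : topologicalZmodType).
Variable alpha : 'rV[int]_d -> X -> X.
Hypothesis acta : is_action alpha.
Hypothesis cX : compact [set: X].
Hypothesis zX : zero_dimensional X.
Hypothesis mX : metrizable R X.
Hypothesis noeth : noetherian R alpha.
Variables (m p : nat).
Hypothesis m0 : (0 < m)%N.
Hypothesis mX0 : forall x : X, x *+ m = 0.
Hypothesis pp : prime p.
Variables n1 n2 : 'rV[int]_d.
Hypothesis entropy : finite_entropy R (alpha n1).

Local Notation red := (map_poly (intr : int -> 'F_p)).
Local Notation red2 := (map_poly (map_poly (intr : int -> 'F_p))).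
Local Notation bact := (bact alpha n1 n2).
Local Notation Y := (@primary X m p).

(** X/U is finite, so finitely many maps to ['F_p] detect [U], and the product of their relations
    sends [X] into [U]. It commutes with the action, so whole orbits land in [U], which by the
    choice of [U] means landing in pX. *)
Lemma relation_mod_p : exists G : {poly {poly int}},
  red2 G != 0 /\ forall x, exists w, bact G x = w *+ p.
Proof.
have [_ _ hM h1] := ring_action_bact acta n1 n2.
have [U [oU pU hU]] := cogenerating_opensub acta cX zX noeth mX p.
have [l hl] := opensub_cosets cX oU.
have ex_v i : exists v : X -> 'F_p, [/\ forall x y, v (x + y) = v x + v y,
    forall x, U x -> v x = 0 & ~ U (nth 0 l i) -> v (nth 0 l i) != 0].
  have [Ui|nUi] := pselect (U (nth 0 l i)).
    by exists (fun=> 0); split=> // x y; rewrite addr0.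
  by have [v [h1' h2 h3]] := Fp_separation R cX pp oU pU nUi; exists v.
have /choice [v hv] := ex_v.
have [G [G0 hG]] : exists G, red2 G != 0 /\
    forall x i, (i < size l)%N -> v i (bact G x) = 0.
  elim: (size l) => [|n [G [G0 hG]]].
    by exists 1; rewrite rmorph1 oner_neq0.
  have [vD vU _] := hv n.
  have [Gn [Gn0 hGn]] := relation_char acta cX n2 pp vD oU vU entropy.
  exists (Gn * G); split; first by rewrite rmorphM mulf_neq0.
  move=> x i; rewrite ltnS leq_eqVlt => /predU1P[->|iln]; first by rewrite hM.
  by rewrite mulrC hM; exact: hG.
have GU x : U (bact G x).
  have [i il Ui] := hl (bact G x); have [vD vU vi] := hv i.
  have [Uli|/vi] := pselect (U (nth 0 l i)).
    by rewrite -(subrK (nth 0 l i) (bact G x)); exact: subgroupD oU.2 Ui Uli.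
  have := hG x i il; rewrite -{1}(subrK (nth 0 l i) (bact G x)) vD (vU _ Ui) add0r => ->.
  by rewrite eqxx.
exists G; split=> // x; apply: hU => n.
by rewrite (bact_alpha acta); exact: GU.
Qed.

(** The lowest power of the second variable is divided out of [G] modulo p, which is harmless since
    that variable acts invertibly. The coefficientwise lift sends 0 to 0 and so keeps the degree,
    hence a leading coefficient nonzero modulo p. *)
Lemma normalized_relation_mod_p : exists H : {poly {poly int}},
  [/\ red H`_0 != 0, red (lead_coef H) != 0 & forall x, exists w, bact H x = w *+ p].
Proof.
have [hD hDl hM h1] := ring_action_bact acta n1 n2.
have [G [G0 hG]] := relation_mod_p.
have [j [h]] := multiplicity_XsubC (red2 G) 0.
rewrite G0 /= subr0 => nrh Gh.
have h00 : h`_0 != 0 by rewrite -horner_coef0.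
have h0 : h != 0 by apply: contra h00 => /eqP ->; rewrite coef0.
pose H : {poly {poly int}} := \poly_(i < size h) lift_poly_Fp h`_i.
have HE i : H`_i = lift_poly_Fp h`_i.
  rewrite coef_poly; case: ltnP => // hi; rewrite nth_default //.
  by rewrite /lift_poly_Fp size_poly0 poly_def big_ord0.
have lift0 (q : {poly 'F_p}) : q != 0 -> lift_poly_Fp q != 0.
  by apply: contra => /eqP e; rewrite -(lift_poly_FpK q) e rmorph0.
have sH : size H = size h.
  rewrite size_poly_eq //; apply: lift0; by rewrite -lead_coefE lead_coef_eq0.
have redH : red2 H = h.
  by apply/polyP => i; rewrite coef_map HE /= lift_poly_FpK.
exists H; split.
- by rewrite HE lift_poly_FpK.
- by rewrite lead_coefE sH HE lift_poly_FpK -lead_coefE lead_coef_eq0.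
- move=> x.
  have red2_0 (Q : {poly {poly int}}) : red2 Q = 0 -> exists r, Q = (p%:Z)%:P%:P * r.
    move=> Q0; have /choice [r hr] : forall i, exists r, Q`_i = p%:Z *: r.
      move=> i; apply: (red_eq0 pp).
      have := congr1 (fun q : {poly {poly 'F_p}} => q`_i) Q0.
      by rewrite coef0 coef_map.
    exists (\poly_(i < size Q) r i); apply/polyP => i.
    rewrite coefCM coef_poly; case: ltnP => hi; last by rewrite nth_default // mulr0.
    by rewrite hr mul_polyC.
  have [|r er] := red2_0 (G - H * 'X^j).
    by rewrite rmorphB rmorphM /= map_polyXn redH Gh subrr.
  have [w hw] := hG x.
  have Xj z : bact 'X^j z = alpha (n2 *+ j) z.
    rewrite /bact poly_actXn ?(iter_alpha acta) //; first exact: ring_action_pact.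
      exact: (alpha_add acta).
    by move=> a y; exact: pact_alpha.
  have pr z : bact (p%:Z%:P%:P * r) z = bact r z *+ p.
    rewrite hM [LHS](poly_actC (alpha n2) (ring_action_pact acta n1)).
    exact: (poly_actC (alpha n1) (ring_action_zact X)).
  have eG : bact G x = alpha (n2 *+ j) (bact H x) + bact r x *+ p.
    by rewrite -(subrK (H * 'X^j) G) er hDl pr hM Xj (bact_alpha acta) addrC.
  exists (alpha (- (n2 *+ j)) (w - bact r x)).
  rewrite -(alphaMn acta) mulrnBl -hw eG addrK -(alphaD acta) addNr (alpha0 acta) //.
Qed.

(** Mapping into pX becomes mapping into p^e X after raising to the power e, and the projection [t]
    onto the p-part kills p^e X. The extreme coefficients of a power are the powers of the extreme
    coefficients. *)
Lemma normalized_relation : exists H : {poly {poly int}},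
  [/\ red H`_0 != 0, red (lead_coef H) != 0 & forall y, Y y -> bact H y = 0].
Proof.
have [hD hDl hM h1] := ring_action_bact acta n1 n2.
have [H [H0 H1 hH]] := normalized_relation_mod_p.
have [t [YT tY]] := primary_projection m0 mX0 pp.
pose e := (logn p m).+1.
exists (H ^+ e); split.
- by rewrite -horner_coef0 horner_exp horner_coef0 rmorphXn expf_neq0.
- by rewrite lead_coef_exp rmorphXn expf_neq0.
- move=> y Yy.
  have pow k x : exists w, bact (H ^+ k) x = w *+ p ^ k.
    elim: k x => [|k IH] x; first by exists x; rewrite expr0 h1 expn0.
    have [w hw] := hH x; have [w' hw'] := IH w; exists w'.
    by rewrite exprSr hM hw (bactMn acta) hw' -mulrnA expnSr.
  have [w hw] := pow e y.
  by rewrite -(tY _ Yy) (bactMn acta) hw -mulrnA mulnC mulrnA; exact: YT.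
Qed.

End NormalRelation.

(** * Patterns over boxes *)

Section Window.
Variables (R : realType) (d : nat) (X : topologicalZmodType).
Variable alpha : 'rV[int]_d -> X -> X.
Hypothesis acta : is_action alpha.
Variable n1 : 'rV[int]_d.
Variables (m p : nat).
Hypothesis pp : prime p.

Local Notation red := (map_poly (intr : int -> 'F_p)).
Local Notation pact := (pact alpha n1).
Local Notation Y := (@primary X m p).
Implicit Types (A U : set X) (q : {poly int}).

Definition window (M : nat) A (w : X) : Prop :=
  forall j : int, (`|j| <= M)%N -> A (alpha (n1 *~ j) w).

Lemma window_le M M' A w : (M <= M')%N -> window M' A w -> window M A w.
Proof. by move=> MM' h j jM; apply: h; exact: leq_trans jM MM'. Qed.

Lemma pact_window q A M D w : subgroup A -> (size q <= D)%N ->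
  window (M + D) A w -> window M A (pact q w).
Proof.
move=> gA qD h j jM; rewrite (pact_alpha acta) /pact /poly_act.
apply: subgroup_sum => // i _; apply: subgroupMz => //.
rewrite (iter_alpha acta) -(alphaD acta) pmulrn -mulrzDr; apply: h.
by have iD := leq_trans (ltn_ord i) qD; move: iD jM; move: (nat_of_ord i) => a; lia.
Qed.

(** Points of [U'] have r + 1 consecutive [n2]-shifts in [U]. Moving by one step asks for one new
    shift, which the relation expresses through the old ones after multiplication by the top
    coefficient (forwards) or the bottom one (backwards); [q] is their product. [U'] occurs both
    before and after the step, which permits iteration. *)
Lemma window_step (n2 : 'rV[int]_d) (H : {poly {poly int}}) :
  red H`_0 != 0 -> red (lead_coef H) != 0 -> (forall y, Y y -> bact alpha n1 n2 H y = 0) ->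
  exists D q, red q != 0 /\ forall U, opensub U -> exists U', [/\ opensub U', U' `<=` U &
    forall M w, Y w -> window (M + D) U' w ->
      [/\ window M U' (pact q w), window M U' (alpha n2 (pact q w)) &
          window M U' (alpha (- n2) (pact q w))]].
Proof.
move=> H00 Hr0 rel.
have Hn0 : H != 0 by apply: contra Hr0 => /eqP ->; rewrite lead_coef0 rmorph0.
pose r := (size H).-1.
have sH : size H = r.+1 by rewrite prednK // lt0n size_poly_eq0.
have {}rel y : Y y -> \sum_(k < r.+1) pact H`_k (alpha (n2 *+ k) y) = 0.
  move=> Yy; rewrite -[RHS](rel y Yy) /bact /poly_act sH.
  by apply: eq_bigr => k _; rewrite (iter_alpha acta).
pose D0 := (\max_(k < r.+1) size (H`_k)%R)%N.
have hD0 (k : 'I_r.+1) : (size (H`_k)%R <= D0)%N.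
  exact: (@leq_bigmax _ (fun k : 'I_r.+1 => size (H`_k)%R)).
have [_ _ hM _] := ring_action_pact acta n1.
have hr : lead_coef H = H`_r by [].
(* Two successive multiplications by coefficients shorten the window by [D0] each. *)
exists (D0 + D0)%N, (H`_0 * H`_r); split; first by rewrite rmorphM mulf_neq0 // -hr.
move=> U oU.
pose U' := [set x | forall k, (k < r.+1)%N -> (alpha (n2 *+ k) @^-1` U) x].
have oU' : opensub U' by apply: opensub_bigI => k; exact: (alpha_opensub acta).
have gU := oU.2; have gU' := oU'.2.
exists U'; split=> //.
  by move=> x /(_ 0%N isT) /=; rewrite mulr0n (alpha0 acta).
move=> M w Yw hw.
have h0 : window (M + D0) U' (pact H`_0 w).
  by apply: (pact_window gU' (hD0 ord0)); rewrite -addnA.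
have hrw : window (M + D0) U' (pact H`_r w).
  by apply: (pact_window gU' (hD0 ord_max)); rewrite -addnA.
have hq : window M U' (pact (H`_0 * H`_r) w).
  by rewrite hM; exact: (pact_window gU' (hD0 ord0)).
have Y0 : Y (pact H`_0 w) by exact: pact_primary.
have Yr : Y (pact H`_r w) by exact: pact_primary.
have shifted (k l : nat) (kr : (k < r.+1)%N) (lr : (l < r.+1)%N) z :
    window (M + D0) U' z -> window M U (pact H`_k (alpha (n2 *+ l) z)).
  move=> hz; apply: (pact_window gU (hD0 (Ordinal kr))) => j jM.
  by rewrite (alphaC acta); exact: hz.
have eqU (a b : 'rV[int]_d) z : a = b -> U (alpha a z) -> U (alpha b z) by move=> ->.
split=> // j jM k kr /=.
- have [kr'|rk] := ltnP k r.
    have h := hq j jM k.+1 kr'; rewrite /= -!(alphaD acta) in h *.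
    by apply: eqU h; rewrite mulrSr -!addrA; congr (_ + _); rewrite addrC.
  have {rk kr}-> : k = r by apply/eqP; rewrite eqn_leq -ltnS kr rk.
  (* The new shift r + 1: the relation at the multiple of [w] by the bottom coefficient is solved
     for its top term. *)
  rewrite mulrC hM.
  have := rel _ Y0; rewrite big_ord_recr /= => /eqP; rewrite addr_eq0 eq_sym eqr_oppLR => /eqP e.
  have -> : alpha (n2 *+ r) (alpha (n1 *~ j) (alpha n2 (pact H`_r (pact H`_0 w)))) =
     alpha (n1 *~ j) (alpha n2 (pact H`_r (alpha (n2 *+ r) (pact H`_0 w)))).
    by rewrite -!(pact_alpha acta) -!(alphaD acta); congr alpha; rewrite -!addrA addrCA; congr (_ + _); rewrite addrC.
  rewrite e !(alphaN acta); apply: subgroupN => //.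
  have -> : alpha (n1 *~ j) (alpha n2 (\sum_(i < r) pact H`_i (alpha (n2 *+ i) (pact H`_0 w)))) =
     \sum_(i < r) alpha (n1 *~ j) (pact H`_i (alpha (n2 *+ i.+1) (pact H`_0 w))).
    rewrite -(alphaD acta).
    rewrite (alpha_sum acta); apply: eq_bigr => i _.
    by rewrite (alphaD acta) [alpha n2 _](pact_alpha acta) -(alphaD acta n2) mulrS.
  apply: subgroup_sum => // i _; have ir : (i < r)%N := ltn_ord i.
  by apply: (@shifted i i.+1) => //; exact: leqW.
- case: k kr => [|k] kr; last first.
    have h := hq j jM k (ltnW kr); rewrite /= -!(alphaD acta) in h *.
    by apply: eqU h; rewrite mulrSr -!addrA; congr (_ + _); rewrite addrCA subrr addr0.
  (* The new shift -1: the relation at the multiple of [w] by the top coefficient is solved for its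
     bottom term. *)
  rewrite mulr0n (alpha0 acta) hM.
  have := rel _ Yr; rewrite big_ord_recl /= mulr0n (alpha0 acta) => /eqP; rewrite addr_eq0 => /eqP ->.
  rewrite !(alphaN acta); apply: subgroupN => //.
  have -> : alpha (n1 *~ j) (alpha (- n2) (\sum_(i < r) pact H`_(bump 0 i) (alpha (n2 *+ bump 0 i) (pact H`_r w)))) =
     \sum_(i < r) alpha (n1 *~ j) (pact H`_(bump 0 i) (alpha (n2 *+ i) (pact H`_r w))).
    rewrite -(alphaD acta).
    rewrite (alpha_sum acta); apply: eq_bigr => i _.
    rewrite (alphaD acta) [alpha (- n2) _](pact_alpha acta) -(alphaD acta (- n2)).
    by rewrite /bump /= add1n mulrS addKr.
  apply: subgroup_sum => // i _; have ir : (i < r)%N := ltn_ord i.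
  by apply: (@shifted (bump 0 i) i) => //; exact: leqW.
Qed.

(** All shifts with [|a| <= N] get the same factor [q ^+ N]: the factors left over after [|a|] moves
    are spent on the clause without shift. A single multiple of [w] thus serves all of them. *)
Lemma window_iter (n2 : 'rV[int]_d) U D q :
  (forall M w, Y w -> window (M + D) U w ->
      [/\ window M U (pact q w), window M U (alpha n2 (pact q w)) &
          window M U (alpha (- n2) (pact q w))]) ->
  forall N M w (a : int), (`|a| <= N)%N -> Y w -> window (M + D * N) U w ->
    window M U (alpha (n2 *~ a) (pact (q ^+ N) w)).
Proof.
have [_ _ hM h1] := ring_action_pact acta n1.
move=> step; elim=> [|N IH] M w a aN Yw hw.
  have -> : a = 0 by lia.
  by rewrite expr0 h1 mulr0z (alpha0 acta); rewrite muln0 addn0 in hw.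
have [|s0 s1 s2] := step (M + D * N)%N w Yw.
  by rewrite -addnA -[X in (_ + X)%N]mulnSr.
have Yq : Y (pact q w) by exact: pact_primary.
rewrite exprSr hM.
have [a0|[a0|a0]] : a = 0 \/ 0 < a \/ a < 0 by lia.
- by rewrite a0 -[0]/(0%N%:Z); apply: IH.
- have := IH M (alpha n2 (pact q w)) (a - 1) _ (primary_alpha acta n2 Yq) s1.
  rewrite -(pact_alpha acta) -(alphaD acta) -[X in alpha (_ + X)]mulr1z -mulrzDr subrK.
  by apply; lia.
- have := IH M (alpha (- n2) (pact q w)) (a + 1) _ (primary_alpha acta (- n2) Yq) s2.
  rewrite -(pact_alpha acta) -(alphaD acta) -[X in alpha (_ + X)]mulrN1z -mulrzDr addrK.
  by apply; lia.
Qed.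

(** Directions are treated in turn, the open subgroup required for one being the target for the
    remaining ones; losses add and factors multiply. *)
Lemma window_multi (I : eqType) (f : I -> 'rV[int]_d) (l : seq I) :
  (forall i, i \in l -> exists H : {poly {poly int}},
    [/\ red H`_0 != 0, red (lead_coef H) != 0 & forall y, Y y -> bact alpha n1 (f i) H y = 0]) ->
  exists D q, red q != 0 /\ forall U, opensub U -> exists U', opensub U' /\
    forall N M w (s : I -> int), Y w -> (forall i, (`|s i| <= N)%N) ->
      window (M + D * N) U' w ->
      window M U (alpha (\sum_(i <- l) f i *~ s i) (pact (q ^+ N) w)).
Proof.
have [_ _ hM h1] := ring_action_pact acta n1.
elim: l => [|i l IH] hl.
  exists 0%N, 1; split; first by rewrite rmorph1 oner_neq0.
  move=> U oU; exists U; split=> // N M w s Yw _.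
  by rewrite mul0n addn0 big_nil (alpha0 acta) expr1n h1.
have [|D [q [q0 hq]]] := IH; first by move=> j jl; apply: hl; rewrite inE jl orbT.
have [H [H0 H1 rel]] := hl i (mem_head _ _).
have [Di [qi [qi0 hqi]]] := window_step H0 H1 rel.
exists (Di + D)%N, (qi * q); split; first by rewrite rmorphM mulf_neq0.
move=> U oU; have [U1 [oU1 U1U step]] := hqi U oU.
have [U2 [oU2 hU2]] := hq U1 oU1.
exists U2; split=> // N M w s Yw sN hw.
have h := hU2 N (M + Di * N)%N w s Yw sN _.
have {}h := h (window_le _ hw).
have := window_iter step (sN i) _ (h _); rewrite -addnA -mulnDl => /(_ _ (leqnn _)) h'.
rewrite big_cons (alphaD acta) exprMn hM (pact_alpha acta _ _ (qi ^+ N)).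
move=> j jM; apply: U1U; apply: h' => //.
by apply: (primary_alpha acta); exact: (pact_primary acta).
Qed.

End Window.

(** * Bounding the fixed points of one element *)

Lemma opensub_separating (X : topologicalZmodType) (F : finType) (g : F -> X) :
  compact [set: X] -> zero_dimensional X -> injective g ->
  exists2 U : set X, opensub U & forall a b, U (g a - g b) -> a = b.
Proof.
move=> cX zX ginj.
have /choice [V hV] : forall ab : F * F, exists V : set X,
    opensub V /\ (V (g ab.1 - g ab.2) -> ab.1 = ab.2).
  move=> [a b] /=; have [->|nab] := eqVneq a b.
    by exists setT; split=> //; exact: opensub_setT.
  apply: contrapT => /forallNP no; move/eqP: nab; apply; apply: ginj.
  apply/eqP; rewrite -subr_eq0; apply/eqP.
  apply: (hausdorff_zero_dim_opensub cX zX) => U oU; apply: contrapT => nU.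
  by apply: (no U).
exists [set x | forall i, (i < #|{: F * F}|)%N -> nth setT [seq V ab | ab <- enum {: F * F}] i x].
  apply: opensub_bigI => i; case: (ltnP i (size (enum {: F * F}))) => h.
    have [ab0 _] : exists ab0 : F * F, true.
      by case: (enum {: F * F}) h => // ab0 _ _; exists ab0.
    by rewrite (nth_map ab0) //; exact: (hV _).1.
  rewrite nth_default; first exact: opensub_setT.
  by rewrite size_map.
move=> a b h; apply: ((hV (a, b)).2).
have := h (index (a, b) (enum {: F * F})).
by rewrite cardE index_mem mem_enum (nth_map (a, b)) ?index_mem ?mem_enum // nth_index ?mem_enum //; apply.
Qed.

Section FixedBound.
Variables (R : realType) (d : nat) (X : topologicalZmodType).
Variable alpha : 'rV[int]_d -> X -> X.
Hypothesis acta : is_action alpha.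
Hypothesis cX : compact [set: X].
Hypothesis zX : zero_dimensional X.
Hypothesis mX : metrizable R X.
Hypothesis noeth : noetherian R alpha.
Hypothesis rank1 : entropy_rank_one R alpha.
Hypothesis alpha_surj : forall n : 'rV[int]_d, n != 0 -> forall x, exists y, alpha n y - y = x.
Variables (m p : nat).
Hypothesis m0 : (0 < m)%N.
Hypothesis mX0 : forall x : X, x *+ m = 0.
Hypothesis pp : prime p.
Variable i1 : 'I_d.

Local Notation n1 := (delta_mx ord0 i1 : 'rV[int]_d).
Local Notation Y := (@primary X m p).
Local Notation red := (map_poly (intr : int -> 'F_p)).

Lemma n1_neq0 : n1 != 0.
Proof. by apply/eqP => /rowP /(_ i1); rewrite !mxE !eqxx. Qed.

Lemma window_box : exists D q, red q != 0 /\ forall U, opensub U -> exists U', opensub U' /\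
  forall N w (s : 'rV[int]_d), Y w -> (forall i, (`|s ord0 i| <= N)%N) ->
    window alpha n1 (D * N) U' w -> U (alpha s (pact alpha n1 (q ^+ N) w)).
Proof.
have rel (i : 'I_d) : i \in enum 'I_d -> exists H : {poly {poly int}},
    [/\ red H`_0 != 0, red (lead_coef H) != 0 &
        forall y, Y y -> bact alpha n1 (delta_mx ord0 i : 'rV[int]_d) H y = 0].
  by move=> _; apply: (normalized_relation acta cX zX mX noeth m0 mX0 pp); exact: rank1.
have [D [q [q0 hq]]] := window_multi acta pp rel.
exists D, q; split=> // U oU; have [U' [oU' hU']] := hq U oU.
exists U'; split=> // N w s Yw sN hw.
have := hU' N 0%N w (fun i => s ord0 i) Yw sN; rewrite add0n => /(_ hw 0 isT).
rewrite mulr0z (alpha0 acta) big_enum /=.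
suff -> : \sum_(i : 'I_d) (delta_mx ord0 i : 'rV[int]_d) *~ s ord0 i = s by [].
rewrite [RHS]row_sum_delta; apply: eq_bigr => i _.
by rewrite -scaler_int intz.
Qed.

Section Shift.
Variable n : 'rV[int]_d.
Hypothesis n0 : n != 0.
Definition diff (x : X) : X := alpha n x - x.

Lemma diffB x y : diff (x - y) = diff x - diff y.
Proof. by rewrite /diff (alphaB acta) opprD addrACA -opprD. Qed.

Lemma diff0 : diff 0 = 0.
Proof. by rewrite /diff (alpha_zero acta) subrr. Qed.

Lemma diffMn x k : diff (x *+ k) = diff x *+ k.
Proof. by rewrite /diff (alphaMn acta) mulrnBl. Qed.

Lemma iter_diffB k x y : iter k diff (x - y) = iter k diff x - iter k diff y.
Proof. by elim: k => //= k ->; rewrite diffB. Qed.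

Lemma iter_diff0 k : iter k diff 0 = 0.
Proof. by elim: k => //= k ->; rewrite diff0. Qed.

Lemma iter_diffD k x y : iter k diff (x + y) = iter k diff x + iter k diff y.
Proof.
by rewrite -{1}(opprK y) -(sub0r y) !iter_diffB iter_diff0 sub0r opprK.
Qed.

Lemma iter_diff_sum k (I : Type) (r : seq I) (F : I -> X) :
  iter k diff (\sum_(i <- r) F i) = \sum_(i <- r) iter k diff (F i).
Proof. by elim/big_rec2: _ => [|i x y _ <-]; rewrite ?iter_diff0 ?iter_diffD. Qed.

Lemma iter_diff_opensub (U : set X) k x : subgroup U ->
  (forall i, (i <= k)%N -> U (alpha (n *+ i) x)) -> U (iter k diff x).
Proof.
move=> gU; elim: k x => [|k IH] x h.
  by have := h 0%N isT; rewrite mulr0n (alpha0 acta).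
rewrite iterSr; apply: IH => i ik; rewrite /diff (alphaB acta).
apply: subgroupB => //; last by apply: h; exact: leqW.
by rewrite -(alphaD acta) -mulrSr; exact: h.
Qed.

Lemma iter_diff_surj k x : Y x -> exists2 y, Y y & iter k diff y = x.
Proof.
move=> Yx; have [t [YT tY]] := primary_projection m0 mX0 pp.
have [y hy] : exists y, iter k diff y = x.
  elim: k => [|k [y hy]]; first by exists x.
  have [z hz] := alpha_surj n0 y; exists z.
  by rewrite iterSr /diff hz.
exists (y *+ t) => //.
suff -> : iter k diff (y *+ t) = iter k diff y *+ t by rewrite hy tY.
by elim: k {hy} => //= k ->; rewrite diffMn.
Qed.

(* The top index where two sequences of fixed points differ survives in
   [iter k diff] of the difference of the corresponding sums. *)
Lemma iter_diff_top (N : nat) (F : finType) (g : F -> X) (y : nat -> X -> X)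
    (t t' : {ffun 'I_N -> F}) :
  (forall a, diff (g a) = 0) -> (forall k a, iter k diff (y k (g a)) = g a) -> t != t' ->
  exists k : 'I_N, t k != t' k /\
    iter k diff (\sum_(j < N) y j (g (t j)) - \sum_(j < N) y j (g (t' j))) = g (t k) - g (t' k).
Proof.
move=> dg hy tt'.
have [k0 hk0] : exists k : 'I_N, t k != t' k.
  apply/existsP; apply: contraNT tt' => /existsPn h; apply/eqP/ffunP => k.
  by apply/eqP; have := h k; rewrite negbK.
pose k := [arg max_(i > k0 | t i != t' i) val i].
have [hk kmax] : t k != t' k /\ forall j : 'I_N, t j != t' j -> (j <= k)%N.
  by rewrite /k; case: arg_maxnP => // i h1 h2.
exists k; split=> //.
have low (j : 'I_N) a : (j < k)%N -> iter k diff (y j (g a)) = 0.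
  move=> jk; rewrite -(subnK (ltnW jk)) iterD hy.
  by rewrite -subn_gt0 in jk; case: (k - j)%N jk => // i _; rewrite iterSr dg iter_diff0.
rewrite iter_diffB !iter_diff_sum -sumrB (bigD1 k) //= !hy big1 ?addr0 // => j jk.
have [jlt|jge|/val_inj ejk] := ltngtP j k; first by rewrite !low // subrr.
- have -> : t j = t' j by apply/eqP; apply: contraLR jge => /kmax; rewrite -leqNgt.
  by rewrite subrr.
- by rewrite ejk eqxx in jk.
Qed.

End Shift.

Lemma fixed_points_bound : exists2 C : R, 0 <= C &
  forall (B : nat) (n : 'rV[int]_d) (F : finType) (g : F -> X),
    n != 0 -> (forall i, (`|n ord0 i| <= B)%N) -> injective g ->
    (forall a, alpha n (g a) = g a) -> (forall a, g a *+ p = 0) ->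
    ln (#|F|%:R : R) <= C * B.+1%:R.
Proof.
have [C C0 hC] := entropy_injective_card cX (rank1 n1).
have [D [q [q0 hq]]] := window_box.
(* The orbit segment used below has length [k0 + 2 L + 1] with [L = D N B] and [N = k0 + 1], at most
   [N (2 D + 1) (B + 1)]; the factor [N] cancels at the end. *)
exists (C * (2 * D + 1)%:R); first by rewrite mulr_ge0.
move=> B n F g n0 nB ginj gfix gp.
have [U oU sepU] := opensub_separating cX zX ginj.
have [U' [oU' hU']] := hq U oU.
have [k0 hk0] := hC U' oU'.
have Yg a : Y (g a) by exact: primary_torsion.
have dg a : diff n (g a) = 0 by rewrite /diff gfix subrr.
have /choice [y hy] : forall k, exists y : X -> X, forall x, Y x -> Y (y x) /\ iter k (diff n) (y x) = x.
  move=> k; have /choice [y hy] : forall x, exists z, Y x -> Y z /\ iter k (diff n) z = x.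
    move=> x; have [Yx|nYx] := pselect (Y x); last by exists 0.
    by have [z Yz hz] := iter_diff_surj n0 k Yx; exists z.
  by exists y.
pose N := k0.+1.
have gY := primary_subgroup X m p.
(* A tuple of [N] points is encoded by adding a preimage of its j-th entry under the j-th power of
   [diff n], and the sum is then divided by [q ^+ (N * B)]. *)
have /choice [z hz] : forall t : {ffun 'I_N -> F}, exists z, Y z /\
    pact alpha n1 (q ^+ (N * B)) z = \sum_(j < N) y j (g (t j)).
  move=> t; have [||z Yz e] := @primary_surj _ _ _ acta alpha_surj m p m0 mX0 pp n1 (q ^+ (N * B)) n1_neq0 _
    (\sum_(j < N) y j (g (t j))).
  - by rewrite rmorphXn expf_neq0.
  - by apply: subgroup_sum => // j _; exact: (hy j _ (Yg _)).1.
  by exists z.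
pose L := (D * (N * B))%N.
(* Shifting by [-L] turns the two-sided window into a forward orbit segment. *)
pose phi (t : {ffun 'I_N -> F}) := alpha (n1 *~ - L%:Z) (z t).
have inj (t t' : {ffun 'I_N -> F}) : (forall i, (i < k0 + (2 * L).+1)%N ->
    U' (iter i (alpha n1) (phi t) - iter i (alpha n1) (phi t'))) -> t = t'.
  move=> h; apply/eqP; apply: contrapT => /negP tt'.
  have [k [tk ek]] := iter_diff_top dg (fun k a => (hy k _ (Yg a)).2) tt'.
  have win : window alpha n1 L U' (z t - z t').
    move=> j jL; have [i ij] : exists i : nat, j + L%:Z = i%:Z.
      by exists `|(j + L%:Z)%R|%N; rewrite gez0_abs //; lia.
    have := h i _; rewrite !(iter_alpha acta) -(alphaB acta) /phi -(alphaB acta) -(alphaD acta).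
    by rewrite pmulrn -mulrzDr -ij addrK; apply; lia.
  have Yw : Y (z t - z t') by apply: subgroupB => //; [exact: (hz t).1|exact: (hz t').1].
  (* The k-th difference is an integer combination of shifts by [n *+ i] with [i <= k < N]; their
     entries are at most [N * B], inside the box controlled by the window. *)
  move/eqP: tk; apply; apply: sepU; rewrite -ek; apply: iter_diff_opensub oU.2 _ => i ik.
  have := hU' (N * B)%N _ (n *+ i) Yw _ win.
  rewrite (ractB (ring_action_pact acta n1)) (hz t).2 (hz t').2; apply => j.
  rewrite mulmxnE -mulr_natr abszM natz absz_nat mulnC leq_mul //.
  by rewrite (leq_trans ik) // ltnW.
have := hk0 _ (leq_addr _ _) _ phi inj.
rewrite card_ffun card_ord natrX.
case: (posnP #|F|) => [->|F0].
  by move=> _; rewrite ln0 // !mulr_ge0.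
rewrite lnXn ?ltr0n // => le1.
have le2 : ln (#|F|%:R : R) *+ N <= (C * (2 * D + 1)%:R * B.+1%:R) *+ N.
  apply: le_trans le1 _; rewrite -[leRHS]mulr_natr -!mulrA ler_wpM2l // -!natrM ler_nat /L /N; nia.
by rewrite ler_pMn2r in le2.
Qed.

End FixedBound.

(** * Counting orbits *)

(** [s] generates a cyclic [q]-group of permutations, so the points other than [x0] fall into orbits
    of size divisible by [q]. *)
Lemma prime_order_fix_mod (F : finType) (s : F -> F) (q : nat) (x0 : F) : prime q ->
  (forall x, iter q s x = x) -> (forall x, s x = x <-> x = x0) -> (#|F| = 1 %[mod q])%N.
Proof.
move=> pq sq fix_s.
have sI : injective s.
  move=> x y e; rewrite -(sq x) -(sq y) -(prednK (prime_gt0 pq)) !iterSr e //.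
pose P := perm sI.
have PX k x : (P ^+ k)%g x = iter k s x.
  by elim: k x => [|k IH] x; rewrite ?expg0 ?perm1 // expgSr permM permE IH.
have Pq : (P ^+ q)%g = 1%g by apply/perm.permP => x; rewrite PX sq perm1.
have qG : (q.-group <[P]>)%g.
  rewrite /pgroup -orderE; apply: pnat_dvd (pnat_id pq).
  by rewrite order_dvdn Pq.
have acts : [acts <[P]>%g, on [set: F]%SET | 'P]%g.
  by apply/fintype.subsetP => a _; rewrite !inE; apply/andP; split=> //; apply/fintype.subsetP => x _; rewrite !inE.
have := pgroup_fix_mod qG acts; rewrite cardsT => ->.
congr (_ %% _)%N; rewrite finset.setTI afix_cycle.
rewrite -(cards1 x0); congr #|pred_of_set _|; apply/finset.setP => x; rewrite finset.in_set1.
apply/afix1P/eqP => [|/fix_s e]; first by rewrite /= apermE permE => /fix_s.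
by rewrite /= apermE permE.
Qed.

(** By Cauchy's theorem a prime dividing the cardinality is the order of an element, and this order
    divides [p]. *)
Lemma finite_subgroup_card (X : zmodType) (A : {fset X}) (p : nat) : prime p ->
  subgroup [set` A] -> (forall v, v \in A -> v *+ p = 0) -> exists a, #|(A : finType)| = (p ^ a)%N.
Proof.
move=> pp gA pA.
pose one : A := @FSetSub X A 0 gA.1.
pose mul (u v : A) : A := @FSetSub X A (val u + val v) (subgroupD gA (valP u) (valP v)).
pose inv (u : A) : A := @FSetSub X A (- val u) (subgroupN gA (valP u)).
have mulA : associative mul by move=> u v w; apply: val_inj; rewrite /= addrA.
have mul1 : left_id one mul by move=> u; apply: val_inj; rewrite /= add0r.
have mulV : left_inverse one inv mul by move=> u; apply: val_inj; rewrite /= addNr.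
pose gT : finGroupType := HB.pack (A : Type) (Finite.class (A : finType)) 
  (isMulGroup.Build (A : Type) mulA mul1 mulV).
have expX (u : gT) k : val (u ^+ k : gT)%g = val u *+ k.
  elim: k => [|k IH]; first by rewrite expg0 mulr0n.
  by rewrite expgS mulrS -IH.
have : p.-nat #|[set: gT]%SET|.
  apply/pnatP; first by rewrite cardG_gt0.
  move=> r pr /Cauchy [] // u _ ur.
  have up : (u ^+ p)%g = 1%g by apply: val_inj; rewrite expX pA //; exact: valP.
  have : (#[u]%g %| p)%N by rewrite order_dvdn up.
  by rewrite ur dvdn_prime2 // inE.
by move=> /p_natP [a]; rewrite cardsT => e; exists a.
Qed.

(** * Sublattices of prime index *)

Lemma index_label (d : nat) (L : set 'rV[int]_d) (q : nat) : subgroupZd L -> index_is L q ->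
  exists (lab : 'rV[int]_d -> 'I_q) (rep : 'I_q -> 'rV[int]_d),
    (forall u v, lab u = lab v <-> L (u - v)) /\ cancel rep lab.
Proof.
move=> gL [s [sq cov inj]]; have gL' : subgroup L by [].
have /choice [lab hlab] : forall v, exists i : 'I_q, L (v - nth 0 s i).
  by move=> v; have [i iq Li] := cov v; exists (Ordinal iq).
exists lab, (fun i => nth 0 s i); split=> [u v|i].
  split=> [e|Luv].
    by apply: (subgroup_trans gL' (hlab u)); rewrite e; exact: (subgroup_sym gL' (hlab v)).
  apply: val_inj; apply: inj; rewrite ?ltn_ord //.
  apply: (subgroup_trans gL' (subgroup_sym gL' (hlab u))).
  exact: (subgroup_trans gL' Luv (hlab v)).
apply: val_inj; apply: inj; rewrite ?ltn_ord //; exact: (subgroup_sym gL' (hlab _)).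
Qed.

(** Lagrange's theorem in Z^d / L, whose group law is transported to the labels. *)
Lemma index_exponent (d : nat) (L : set 'rV[int]_d) (q : nat) : subgroupZd L -> index_is L q ->
  forall v, L (v *+ q).
Proof.
move=> gL iL v; have gL' : subgroup L by [].
have [lab [rep [labE repK]]] := index_label gL iL.
pose mul i j := lab (rep i + rep j).
have labD u w : lab (u + w) = mul (lab u) (lab w).
  apply/labE; rewrite opprD addrACA.
  by apply: subgroupD => //; apply/labE; rewrite repK.
have mulA : associative mul.
  by move=> i j k; rewrite -(repK i) -(repK j) -(repK k) -!labD addrA.
have mul1 : left_id (lab 0) mul.
  by move=> i; rewrite -(repK i) -labD add0r.
have mulV : left_inverse (lab 0) (fun i => lab (- rep i)) mul.
  by move=> i; rewrite -{2}(repK i) -labD addNr.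
pose gT : finGroupType := HB.pack ('I_q : Type) (Finite.class ('I_q : finType))
  (isMulGroup.Build ('I_q : Type) mulA mul1 mulV).
have labX k : lab (v *+ k) = ((lab v : gT) ^+ k)%g :> gT.
  elim: k => [|k IH]; first by rewrite mulr0n expg0.
  by rewrite mulrS expgS -IH; exact: labD.
have : lab (v *+ q) = lab 0.
  rewrite labX -[X in (_ ^+ X)%g](card_ord q) -(cardsT 'I_q).
  by rewrite (@expg_cardG gT [group of [set: gT]%SET]) ?finset.in_setT.
by move/labE; rewrite subr0.
Qed.

(* Pigeonhole form of Minkowski's theorem for the sublattice [L]. *)
Lemma short_vector (d : nat) (L : set 'rV[int]_d) (q : nat) : (0 < d)%N ->
  subgroupZd L -> index_is L q -> exists (B : nat) (n : 'rV[int]_d),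
    [/\ (B ^ d <= q)%N, L n, n != 0 & forall i, (`|n ord0 i| <= B)%N].
Proof.
move=> d0 gL iL; have [lab [rep [labE repK]]] := index_label gL iL.
have ex : exists b, (q < b.+1 ^ d)%N.
  by exists q; rewrite (leq_trans (ltnSn q)) // -{1}(expn1 q.+1) leq_pexp2l.
case: (ex_minnP ex) => B hB minB.
have Bq : (B ^ d <= q)%N.
  case: B hB minB => [|b] hB minB; first by rewrite exp0n.
  by rewrite leqNgt; apply/negP => /minB; rewrite ltnn.
pose f (t : {ffun 'I_d -> 'I_B.+1}) := lab (\row_i (t i : nat)%:Z).
have /injectivePn [t [t' ntt' e]] : ~~ injectiveb f.
  apply/negP => /injectiveP /leq_card.
  by rewrite card_ffun !card_ord leqNgt hB.
exists B, ((\row_i (t i : nat)%:Z) - (\row_i (t' i : nat)%:Z)); split=> //.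
- exact/labE.
- apply: contra ntt' => /eqP /rowP h; apply/eqP/ffunP => i; apply: val_inj.
  by have := h i; rewrite !mxE => /eqP; rewrite subr_eq0 => /eqP [].
- move=> i; rewrite !mxE; have := ltn_ord (t i); have := ltn_ord (t' i); lia.
Qed.

Lemma growth_contradiction (R : realType) (d : nat) (C eps : R) : (0 < d)%N -> 0 <= C -> 0 < eps ->
  exists Q0 : nat, forall q B k a p : nat, (Q0 <= q)%N -> prime p -> (B ^ d <= q)%N ->
    (q%:R : R) `^ (d%:R^-1 + eps) < k%:R -> (k <= a)%N ->
    ~ ln ((p ^ a)%:R : R) <= C * B.+1%:R.
Proof.
move=> d0 C0 e0.
have ln2 : 0 < ln (2%:R : R) by rewrite ln_gt0 // ltr1n.
(* With x = q^(1/d), [C (B + 1) <= 2 C x = K x ln 2], while [a ln p] exceeds [(K + 1) x ln 2] once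
   q^eps is at least K + 1. Bounding ln p below by ln 2 keeps the threshold independent of [p]. *)
pose K := 2 * C / ln (2%:R : R).
have K0 : 0 <= K by rewrite divr_ge0 ?mulr_ge0 // ltW.
exists (Num.truncn ((K + 1) `^ eps^-1)).+1 => q B k a p Qq pp Bq qk ka le.
have q0 : (0 < q)%N by exact: leq_trans Qq.
have qR : (K + 1) `^ eps^-1 <= q%:R.
  by apply: (le_trans (ltW (truncnS_gt _))); rewrite ler_nat.
have qeK : K + 1 <= (q%:R : R) `^ eps.
  have := ge0_ler_powR (ltW e0) _ _ qR; rewrite !nnegrE powR_ge0 ler0n => /(_ isT isT).
  by rewrite -powRrM mulVf ?gt_eqF // powRr1 // addr_ge0.
pose x := (q%:R : R) `^ d%:R^-1.
have dR : (d%:R : R) != 0 by rewrite pnatr_eq0 -lt0n.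
have rootx (b : nat) : (b ^ d <= q)%N -> b%:R <= x.
  move=> bq; have -> : (b%:R : R) = ((b ^ d)%:R : R) `^ d%:R^-1.
    by rewrite natrX -powR_mulrn // -powRrM divff // powRr1.
  by apply: ge0_ler_powR; rewrite ?nnegrE ?ler0n ?invr_ge0 ?ler0n // ler_nat.
have x1 : 1 <= x by apply: (rootx 1%N); rewrite exp1n.
have xB := rootx B Bq.
have qx : (q%:R : R) `^ (d%:R^-1 + eps) = x * q%:R `^ eps.
  by rewrite powRD //; apply/implyP => _; rewrite pnatr_eq0 -lt0n.
have lnp : ln (2%:R : R) <= ln (p%:R : R).
  by rewrite ler_ln ?posrE ?ltr0n ?prime_gt0 // ler_nat prime_gt1.
have p0 : 0 < (p%:R : R) by rewrite ltr0n prime_gt0.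
rewrite natrX lnXn // -[ln _ *+ a]mulr_natl in le.
have ka' : (k%:R : R) <= a%:R by rewrite ler_nat.
have h1 : x * (K + 1) <= k%:R.
  by apply: ltW; apply: le_lt_trans qk; rewrite qx ler_wpM2l // (le_trans _ x1).
have h2 : x * (K + 1) * ln (2%:R : R) <= a%:R * ln (p%:R : R).
  apply: ler_pM => //; first by rewrite mulr_ge0 ?addr_ge0 // (le_trans _ x1).
    exact: ltW.
  exact: le_trans h1 ka'.
have KE : K * ln (2%:R : R) = 2 * C by rewrite /K divfK ?gt_eqF.
have h3 : C * B.+1%:R <= C * (2 * x).
  by apply: ler_wpM2l => //; rewrite -natr1; lra.
have : x * (K + 1) * ln (2%:R : R) <= C * (2 * x) by exact: le_trans h2 (le_trans le h3).
have -> : x * (K + 1) * ln (2%:R : R) = C * (2 * x) + x * ln (2%:R : R).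
  by rewrite mulrDr mulr1 mulrDl -mulrA KE; ring.
have : 0 < x * ln (2%:R : R) by rewrite mulr_gt0 // (lt_le_trans _ x1).
lra.
Qed.

Lemma mult_order_exists (p q a : nat) : (0 < a)%N -> (p ^ a = 1 %[mod q])%N ->
  exists2 k, (k <= a)%N & mult_order p q k.
Proof.
move=> a0 pa.
have ex : exists k, (0 < k)%N && ((p ^ k) %% q == 1 %% q)%N.
  by exists a; rewrite a0 /=; apply/eqP.
case: (ex_minnP ex) => k /andP[k0 /eqP pk] kmin; exists k.
  by apply: kmin; rewrite a0; apply/eqP.
split=> // j j0 jk e; have := kmin j; rewrite j0 e eqxx => /(_ isT).
by rewrite leqNgt jk.
Qed.

(** * The theorem *)

(* A subgroup containing [M Z^d] is determined by its residues modulo [M]. *)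
Lemma bounded_exponent_values (d : nat) (X : Type) (alpha : 'rV[int]_d -> X -> X) (M : nat) :
  (0 < M)%N -> exists s : seq nat, forall L : set 'rV[int]_d, subgroup L ->
    (forall v, L (v *+ M)) -> finite_set (Fix alpha L) ->
    exists2 k, k \in s & (Fix alpha L #= `I_k)%card.
Proof.
case: M => // M _.
pose lift (t : {ffun 'I_d -> 'I_M.+1}) : 'rV[int]_d := \row_i (t i : nat)%:Z.
pose code (L : set 'rV[int]_d) := [set t | `[< L (lift t) >]]%SET.
have codeP L : subgroup L -> (forall v, L (v *+ M.+1)) -> forall v : 'rV[int]_d,
    L v <-> [ffun i => inord `|(v ord0 i %% M.+1)%Z|%N] \in code L.
  move=> gL LM v; rewrite inE; set t := finfun _.
  have -> : v = lift t + (\row_i (v ord0 i %/ M.+1)%Z) *+ M.+1.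
    apply/rowP => i; rewrite !mxE mulmxnE !mxE ffunE inordK; last first.
      by rewrite -ltz_nat gez0_abs ?modz_ge0 // ltz_mod.
    rewrite gez0_abs ?modz_ge0 // {1}(divz_eq (v ord0 i) M.+1) addrC; congr (_ + _).
    by rewrite -mulr_natr natz.
  rewrite addrC (subgroupDl _ gL (LM _)); split=> [h|/asboolP //].
  exact/asboolP.
have /choice [K hK] : forall S, exists k, forall L, subgroup L -> (forall v, L (v *+ M.+1)) ->
    code L = S -> finite_set (Fix alpha L) -> (Fix alpha L #= `I_k)%card.
  move=> S.
  have [[L0 [gL0 LM0 eL0 [k hk]]]|no] := pselect (exists L0 : set 'rV[int]_d,
    [/\ subgroup L0, forall v, L0 (v *+ M.+1), code L0 = S & finite_set (Fix alpha L0)]).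
    exists k => L gL LM eL _; rewrite (_ : L = L0) //.
    by apply/seteqP; split=> v; rewrite (codeP _ gL LM) (codeP _ gL0 LM0) eL eL0.
  by exists 0%N => L gL LM eL fL; exfalso; apply: no; exists L.
exists [seq K A | A <- enum {set {ffun 'I_d -> 'I_M.+1}}] => L gL LM fL.
by exists (K (code L)); [apply: map_f; rewrite mem_enum|exact: hK].
Qed.

(** * Points of [Fix alpha L] moved by the action *)

Section LargeIndex.
Variables (R : realType) (d : nat) (X : topologicalZmodType).
Variable alpha : 'rV[int]_d -> X -> X.
Hypothesis d0 : (0 < d)%N.
Hypothesis acta : is_action alpha.
Hypothesis cX : compact [set: X].
Hypothesis mX : metrizable R X.
Hypothesis zX : zero_dimensional X.
Hypothesis noeth : noetherian R alpha.
Hypothesis rank1 : entropy_rank_one R alpha.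
Hypothesis mixa : mixing R alpha.

Lemma Fix_subgroup (L : set 'rV[int]_d) : subgroup (Fix alpha L).
Proof.
split=> [n _|x y hx hy n Ln]; first by rewrite (alpha_zero acta).
by rewrite (alphaB acta) hx // hy.
Qed.

Lemma Fix_alpha L n x : Fix alpha L x -> Fix alpha L (alpha n x).
Proof. by move=> hx k Lk; rewrite (alphaC acta) hx. Qed.

(** Two distinct [p]-torsion points force [p] to divide the exponent [m] of [X]; the constants for
    all [p <= m] are added up. *)
Lemma uniform_fixed_points_bound : exists2 C : R, 0 <= C &
  forall p (B : nat) (n : 'rV[int]_d) (F : finType) (g : F -> X), prime p ->
    n != 0 -> (forall i, (`|n ord0 i| <= B)%N) -> injective g -> (1 < #|F|)%N ->
    (forall a, alpha n (g a) = g a) -> (forall a, g a *+ p = 0) ->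
    ln (#|F|%:R : R) <= C * B.+1%:R.
Proof.
have [m m0 mX0] := bounded_exponent acta cX zX noeth.
have surj := mixing_surjective acta cX zX mX mixa.
have /choice [C hC] : forall p, exists C : R, 0 <= C /\ (prime p ->
  forall (B : nat) (n : 'rV[int]_d) (F : finType) (g : F -> X),
    n != 0 -> (forall i, (`|n ord0 i| <= B)%N) -> injective g ->
    (forall a, alpha n (g a) = g a) -> (forall a, g a *+ p = 0) ->
    ln (#|F|%:R : R) <= C * B.+1%:R).
  move=> p; have [pp|np] := boolP (prime p); last by exists 0.
  have [C C0 hC] := fixed_points_bound acta cX zX mX noeth rank1 surj m0 mX0 pp (Ordinal d0).
  by exists C.
exists (\sum_(p < m.+1) C p); first by apply: sumr_ge0 => p _; exact: (hC p).1.
move=> p B n F g pp n0 nB ginj F1 gfix gp.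
have pm : (p <= m)%N.
  apply: dvdn_leq => //; apply: contraLR F1 => npm; rewrite -leqNgt.
  have cpm : coprime p m by rewrite prime_coprime.
  apply/card_le1P => a _ b; rewrite !inE; apply/esym/eqP; apply: ginj.
  have g0 c : g c = 0.
    exact: coprime_torsion_eq0 (prime_gt0 pp) cpm (gp c) (mX0 (g c)).
  by rewrite !g0.
apply: le_trans ((hC p).2 pp B n F g n0 nB ginj gfix gp) _.
rewrite ler_wpM2r // (bigD1 (Ordinal (pm : p < m.+1)%N)) //= lerDl.
by apply: sumr_ge0 => i _; exact: (hC i).1.
Qed.

(* On the [p]-torsion elements of [Fix L] of norm zero, [alpha g] acts without nonzero fixed
   points and with prime order [q]. *)
Lemma moved_torsion (L : set 'rV[int]_d) (q : nat) (x : X) (g : 'rV[int]_d) :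
  subgroup L -> prime q -> L (g *+ q) -> finite_set (Fix alpha L) ->
  Fix alpha L x -> alpha g x <> x -> ~ in_Palpha R alpha q ->
  exists p a (F : finType) (h : F -> X), [/\ in_Palpha R alpha p /\ injective h,
    forall b, Fix alpha L (h b) /\ h b *+ p = 0, (1 < #|F|)%N,
    #|F| = (p ^ a)%N & (p ^ a = 1 %[mod q])%N].
Proof.
move=> gL pq Lgq finL Lx gx nPq.
have [m m0 mX0] := bounded_exponent acta cX zX noeth.
pose z := alpha g x - x.
have z0 : z <> 0 by move=> /eqP; rewrite subr_eq0 => /eqP.
have gF := Fix_subgroup L.
have Lz : Fix alpha L z by exact: (subgroupB gF (Fix_alpha g Lx) Lx).
have [e [e0 ze emin]] : exists e, [/\ (0 < e)%N, z *+ e = 0 &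
    forall k, (0 < k < e)%N -> ~ z *+ k = 0].
  by apply: (@min_order X [set 0]); exists m.
have e1 : (1 < e)%N.
  by rewrite ltn_neqAle e0 andbT; apply/eqP => e1; apply: z0; rewrite -ze -e1.
pose p := pdiv e; have pp : prime p by exact: pdiv_prime.
have pe : (e %/ p * p = e)%N by rewrite divnK // pdiv_dvd.
(* An element of order [p] among the multiples of [z]; it inherits norm zero from [z], a difference
   of two points of equal norm. *)
pose y := z *+ (e %/ p).
have yp : y *+ p = 0 by rewrite -mulrnA pe.
have y0 : y <> 0.
  apply: emin; rewrite divn_gt0 ?prime_gt0 // dvdn_leq ?pdiv_dvd //=.
  by rewrite ltn_Pdiv // prime_gt1.
have Pp : in_Palpha R alpha p by exact: (in_Palpha_of_torsion acta noeth cX zX pp m0 mX0 yp y0).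
have pnq : p != q by apply: contra_notN nPq => /eqP <-.
pose s := alpha g.
pose norm v := \sum_(i < q) alpha (g *+ i) v.
have normB u v : norm (u - v) = norm u - norm v.
  by rewrite /norm -sumrB; apply: eq_bigr => i _; rewrite (alphaB acta).
(* Applying [s] rotates the sum; the term that wraps around comes back because [g *+ q] lies in [L],
   which fixes [v]. *)
have norm_s v : Fix alpha L v -> norm (s v) = norm v.
  move=> Lv; rewrite /norm; case: q pq Lgq {nPq pnq norm normB} => // q _ Lgq.
  rewrite big_ord_recr [RHS]big_ord_recl addrC mulr0n (alpha0 acta) /= /s.
  rewrite -(alphaD acta) -mulrSr (Lv _ Lgq); congr (_ + _).
  by apply: eq_bigr => i _; rewrite -(alphaD acta) -mulrSr.
have normMn v k : norm (v *+ k) = norm v *+ k.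
  by rewrite /norm -sumrMnl; apply: eq_bigr => i _; rewrite (alphaMn acta).
pose V := [set v | [/\ Fix alpha L v, v *+ p = 0 & norm v = 0]].
have norm0 : norm 0 = 0 by have := normB 0 0; rewrite !subrr.
have gV : subgroup V.
  split; first by split; [exact: (subgroup0 gF)|rewrite mul0rn|].
  move=> u v [Lu up Nu] [Lv vp Nv]; split; first exact: (subgroupB gF Lu Lv).
    by rewrite mulrnBl up vp subrr.
  by rewrite normB Nu Nv subrr.
have Vy : V y.
  split=> //; first exact: (subgroupMn _ gF Lz).
  by rewrite normMn /z normB norm_s // subrr mul0rn.
have finV : finite_set V by apply: sub_finite_set finL => v [].
have /finite_fsetP [A VA] := finV.
have VE v : V v <-> v \in A by rewrite VA.
have gA : subgroup [set` A] by rewrite -VA.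
have Ap v : v \in A -> v *+ p = 0 by move=> /VE [].
have [a cardA] := finite_subgroup_card pp gA Ap.
have Vs v : V v -> V (s v).
  move=> [Lv vp Nv]; split; first exact: Fix_alpha.
    by rewrite /s -(alphaMn acta) vp (alpha_zero acta).
  by rewrite norm_s.
have As (v : A) : s (val v) \in A by apply/VE; apply: Vs; apply/VE; exact: valP.
pose sA (v : A) : A := @FSetSub X A (s (val v)) (As v).
have sAX k (v : A) : val (iter k sA v) = alpha (g *+ k) (val v).
  by elim: k => [|k IH]; rewrite ?mulr0n ?(alpha0 acta) //= IH /s -(alphaD acta) -mulrS.
pose zero : A := @FSetSub X A 0 gA.1.
exists p, a, (A : finType), (fun v : A => val v); split=> //.
- by move=> b; have [] := (VE (val b)).2 (valP b).
- rewrite ltnNge; apply/negP => /card_le1P h; apply: y0.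
  pose Y : A := @FSetSub X A y ((VE y).1 Vy).
  have := h zero isT Y; rewrite !inE => /esym /eqP.
  by move/(congr1 val).
- rewrite -cardA; apply: (@prime_order_fix_mod A sA q zero pq) => v.
    apply: val_inj; rewrite sAX; have [Lv _ _] := (VE (val v)).2 (valP v).
    exact: Lv.
  split=> [e'|->]; last by apply: val_inj; rewrite /= /s (alpha_zero acta).
  apply: val_inj => /=; have [Lv vp Nv] := (VE (val v)).2 (valP v).
  have sv : s (val v) = val v by have := congr1 val e'.
  (* The norm of a fixed point is its [q]-fold multiple. *)
  have vq : val v *+ q = 0.
    rewrite -Nv /norm (eq_bigr (fun=> val v)) ?sumr_const ?card_ord // => i _.
    by rewrite -(sAX i v) (_ : iter i sA v = v) //; elim: (val i) => //= j ->.
  have cpq : coprime p q by rewrite prime_coprime // dvdn_prime2.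
  exact: coprime_torsion_eq0 (prime_gt0 pp) cpq vp vq.
Qed.

End LargeIndex.

Unset Implicit Arguments.
Theorem theorem2p9 (R : realType) (d : nat) (X : topologicalZmodType)
  (alpha : 'rV[int]_d -> X -> X) :
  (2 <= d)%N ->
  is_action alpha ->
  compact [set: X] ->
  metrizable R X ->
  zero_dimensional X ->
  noetherian R alpha ->
  entropy_rank_one R alpha ->
  mixing R alpha ->
  forall eps : R, 0 < eps ->
    exists s : seq nat, forall L : set 'rV[int]_d, in_Ld alpha eps L ->
      ~ finite_set (Fix alpha L) \/
      exists2 k : nat, k \in s & (Fix alpha L #= `I_k)%card.
Proof.
move=> d2 acta cX mX zX noeth rank1 mixa eps eps0.
have d0 : (0 < d)%N by exact: ltnW.
have [C C0 hC] := uniform_fixed_points_bound d0 acta cX mX zX noeth rank1 mixa.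
have [Q0 hQ0] := growth_contradiction d0 C0 eps0.
have [s hs] := bounded_exponent_values alpha (fact_gt0 Q0).
(* The default 0 covers an infinite fixed set of the whole action, a case excluded once that set
   equals a finite [Fix alpha L]. *)
have [k0 hk0] : exists k0, finite_set (Fix alpha setT) -> (Fix alpha setT #= `I_k0)%card.
  by have [[k hk]|nf] := pselect (finite_set (Fix alpha setT)); [exists k|exists 0%N].
exists (k0 :: s) => L [gL [q [iL pq nPq hq]]].
have [finL|] := pselect (finite_set (Fix alpha L)); [right|by left].
have Lq := index_exponent gL iL.
have [Qq|qQ] := leqP Q0 q; last first.
  have [|k ks hk] := hs L gL _ finL; last by exists k => //; rewrite inE ks orbT.
  move=> v; have /dvdnP [c ->] : (q %| Q0`!)%N by apply: dvdn_fact; rewrite prime_gt0 //= ltnW.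
  by rewrite mulnC mulrnA; exact: subgroupMn.
suff FE : Fix alpha L = Fix alpha setT.
  by exists k0; rewrite ?mem_head // FE; apply: hk0; rewrite -FE.
apply/seteqP; split=> x hx n; last by move=> _; exact: hx.
(* A point moved by [alpha n] yields a torsion group of order [p ^ a], with [a] at least the order
   of [p] modulo [q]; this is too large for the bound coming from a short vector of [L]. *)
move=> _; apply: contrapT => nx.
have [p [a [F [h [[Pp hinj] hF F1 cF pa]]]]] :=
  moved_torsion acta cX zX noeth gL pq (Lq n) finL hx nx nPq.
have pp : prime p by case: Pp.
have a0 : (0 < a)%N by rewrite lt0n; apply/eqP => a0; rewrite cF a0 expn0 in F1.
have [k ka ordk] := mult_order_exists a0 pa.
have [B [v [Bq Lv v0 vB]]] := short_vector d0 gL iL.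
apply: (hQ0 q B k a p Qq pp Bq (hq p Pp k ordk) ka).
rewrite -cF; apply: (hC p B v F h pp v0 vB hinj F1).
  by move=> b; exact: (hF b).1.
by move=> b; exact: (hF b).2.
Qed.
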